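(* Let $n\ge1$ and let $L$ be a regular parametric Lagrangian on $T^n_\circ M$. Then any Euler-Lagrange field of $L$ (a differential equation field on $T^{2n-1}_\circ M$) is homogeneous.
   Context: Manifolds are $C^\infty$, Hausdorff, second-countable and connected. $M$ is a manifold of dimension $m$ with local coordinates $(y^i)$. For $k\ge1$, $T^kM$ is the manifold of $k$-jets at zero $j^k_0\gamma$ of curves $\gamma:(a,b)\to M$ with $0\in(a,b)$, with local coordinates $y^i_r(j^k_0\gamma)=\frac{d^r\gamma^i}{dx^r}(0)$, $0\le r\le k$. $T^k_\circ M\subset T^kM$ is the open submanifold of jets with $\gamma'(0)\ne0$. The projections $T^{k+1}M\to T^kM$ are denoted $\tau_{k+1,k}$, and pull-backs of forms by these projections are usually left understood. Repeated index $i$ is summed. On $T^k_\circ M$ there are canonical vector fields $\Delta^r=\sum_{s=r}^k\frac{s!}{(s-r)!}\,y^i_{s+1-r}\frac{\partial}{\partial y^i_s}$, $r=1,\dots,k$. A differential equation field on $T^k_\circ M$ is a vector field of the form $\Gamma=\sum_{r=0}^{k-1}y^i_{r+1}\frac{\partial}{\partial y^i_r}+\Gamma^i\frac{\partial}{\partial y^i_k}$ with smooth $\Gamma^i$. It is homogeneous if the distribution on $T^k_\circ M$ spanned by $\Gamma,\Delta^1,\dots,\Delta^k$ is involutive. The vertical endomorphism on $T^kM$ is the canonical type $(1,1)$ tensor field $S=\sum_{r=1}^k r\frac{\partial}{\partial y^i_r}\otimes dy^i_{r-1}$; it acts on 1-forms by $S(dy^i_r)=r\,dy^i_{r-1}$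 for $r\ge1$, $S(dy^i_0)=0$. The total derivative $d_{\mathrm T}$ maps functions and forms on $T^k_\circ M$ to functions and forms on $T^{k+1}_\circ M$: it is the derivation commuting with $d$ with $d_{\mathrm T}f=\sum_{r=0}^k y^i_{r+1}\frac{\partial f}{\partial y^i_r}$, so $d_{\mathrm T}dy^i_r=dy^i_{r+1}$. A Lagrangian is a smooth function $L$ on $T^n_\circ M$. It is parametric if it satisfies the Zermelo conditions $\Delta^1(L)=L$ and $\Delta^r(L)=0$ for $2\le r\le n$. Its Hilbert form is the 1-form on $T^{2n-1}_\circ M$ $$\vartheta=\sum_{p=0}^{n-1}\frac{(-1)^p}{(p+1)!}\,d_{\mathrm T}^{\,p}S^{p+1}dL .$$ The characteristic distribution of $d\vartheta$ is $\ker d\vartheta=\{\xi\in TT^{2n-1}_\circ M: i_\xi d\vartheta=0\}$. The parametric Lagrangian $L$ is regular if $\ker d\vartheta$ has dimension $2n$ (at every point). An Euler-Lagrange field of $L$ is any differential equation field on $T^{2n-1}_\circ M$ which lies in $\ker d\vartheta$. *)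

(* Defs.v *)
From HB Require Import structures.
From mathcomp Require Import all_boot all_order all_algebra.
From mathcomp Require Import all_classical all_reals all_analysis.

Set Implicit Arguments.
Unset Strict Implicit.
Unset Printing Implicit Defensive.

Import Order.TTheory GRing.Theory Num.Theory.
Import numFieldNormedType.Exports.

Local Open Scope classical_set_scope.
Local Open Scope ring_scope.

(* C^oo on the open set U: every iterated directional derivative exists and
   is (Frechet) differentiable at every point of U. *)
Definition smooth_on (R : realType) (V W : normedModType R) (U : set V)
    (f : V -> W) : Prop :=
  forall (vs : seq V) (x : V), U x ->
    differentiable (foldr (fun v g => 'D_v g) f vs) x.

Record chart (R : realType) (m : nat) (M : topologicalType) := Chart {
  chart_dom : set M;
  chart_im : set 'rV[R]_m;
  chart_map : M -> 'rV[R]_m;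
  (* only meaningful on chart_im *)
  chart_inv : 'rV[R]_m -> M;
  chart_dom_open : open chart_dom;
  chart_im_open : open chart_im;
  chart_map_im : forall p, chart_dom p -> chart_im (chart_map p);
  chart_inv_dom : forall u, chart_im u -> chart_dom (chart_inv u);
  chart_mapK : forall p, chart_dom p -> chart_inv (chart_map p) = p;
  chart_invK : forall u, chart_im u -> chart_map (chart_inv u) = u;
  chart_map_cont : forall p, chart_dom p -> {for p, continuous chart_map};
  chart_inv_cont : forall u, chart_im u -> {for u, continuous chart_inv} }.

(* The atlas is not required to be maximal: every notion below is invariant
   under changes of coordinates. *)
Record manifold (R : realType) (m : nat) := Manifold {
  man_pt :> topologicalType;
  man_hausdorff : hausdorff_space man_pt;
  man_second_countable : @second_countable man_pt;
  man_connected : connected [set: man_pt];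
  atlas : set (chart R m man_pt);
  atlas_cover : forall p : man_pt, exists2 c, atlas c & chart_dom c p;
  atlas_smooth : forall c c', atlas c -> atlas c' ->
    smooth_on [set u | chart_im c u /\ chart_dom c' (chart_inv c u)]
      (chart_map c' \o chart_inv c) }.

Section Jets.
Context {R : realType} {m : nat} (M : manifold R m).
Local Notation chart := (chart R m M).

(* A curve near 0 is a total function R -> M that is smooth on some ]a, b[
   containing 0; its values outside ]a, b[ are irrelevant. *)
Definition smooth_curve (g : R -> M) : Prop :=
  exists a b : R, [/\ a < 0, 0 < b & forall t, a < t < b ->
    exists c : chart, exists J : set R,
      [/\ atlas c, open J, J t, J `<=` g @^-1` chart_dom c
        & smooth_on J (chart_map c \o g)]].

(* The coordinates y^i_r of the k-jet at 0 of g: row r is the r-th derivative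
   of the curve read in the chart c. *)
Definition jcoord (c : chart) (k : nat) (g : R -> M) : 'M[R]_(k.+1, m) :=
  \matrix_(r, i) ((chart_map c \o g)^`(r)%classic 0) 0 i.

(* The k-jet of g at 0, as an equivalence class of curves. *)
Definition jet (k : nat) (g : R -> M) : set (R -> M) :=
  [set h | [/\ smooth_curve h, h 0 = g 0 & forall c : chart, atlas c ->
    chart_dom c (g 0) -> jcoord c k h = jcoord c k g]].

(* T^k_o M, the k-jets with nonzero velocity; subsets of T^kM are represented
   by sets of classes. *)
Definition slit_jets (k : nat) : set (set (R -> M)) :=
  [set j | exists g : R -> M, [/\ smooth_curve g, j = jet k g &
    exists c : chart, [/\ atlas c, chart_dom c (g 0) &
      (chart_map c \o g)^`()%classic 0 != 0]]].

(* The curve which in the chart c is the Taylor polynomial with derivatives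
   y_0, ..., y_k at 0; its k-jet is the jet with coordinates y. *)
Definition taylor_curve (c : chart) (k : nat) (y : 'M[R]_(k.+1, m)) : R -> M :=
  fun t => chart_inv c (\sum_(r < k.+1) (t ^+ r / r`!%:R) *: row r y).

(* The coordinate image, in the chart of T^kM induced by c, of a set U of
   k-jets. *)
Definition jlocal (k : nat) (U : set (set (R -> M))) (c : chart) :
    set 'M[R]_(k.+1, m) :=
  [set y | chart_im c (row 0 y) /\ U (jet k (taylor_curve c y))].
Arguments jlocal : clear implicits.

Definition open_jets (k : nat) (U : set (set (R -> M))) : Prop :=
  U `<=` slit_jets k /\ forall c : chart, atlas c -> open (jlocal k U c).

(* The coordinate expression of a function on (an open subset of) T^kM. *)
Definition local_fun (k : nat) (f : set (R -> M) -> R) (c : chart) :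
    'M[R]_(k.+1, m) -> R :=
  fun y => f (jet k (taylor_curve c y)).
Arguments local_fun : clear implicits.

(* The change of coordinates of T^kM from the chart c to the chart c'. *)
Definition jtrans (k : nat) (c c' : chart) :
    'M[R]_(k.+1, m) -> 'M[R]_(k.+1, m) :=
  fun y => jcoord c' k (taylor_curve c y).
Arguments jtrans : clear implicits.

(* A vector field on the open subset U of T^k_o M: X c y is the matrix of its
   components at the point with coordinates y, the (s, i) entry being the
   coefficient of d/dy^i_s; it transforms by the differential of jtrans. *)
Definition vector_field (k : nat) (U : set (set (R -> M)))
    (X : chart -> 'M[R]_(k.+1, m) -> 'M[R]_(k.+1, m)) : Prop :=
  (forall c, atlas c -> smooth_on (jlocal k U c) (X c)) /\
  (forall c c', atlas c -> atlas c' -> forall y, jlocal k U c y ->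
     chart_dom c' (chart_inv c (row 0 y)) ->
     X c' (jtrans k c c' y) = 'D_(X c y) (jtrans k c c') y).

Definition bracket (k : nat) (X Y : 'M[R]_(k.+1, m) -> 'M[R]_(k.+1, m))
    (y : 'M[R]_(k.+1, m)) : 'M[R]_(k.+1, m) :=
  'D_(X y) Y y - 'D_(Y y) X y.

(* Involutivity of a distribution D on T^k_o M (given in charts), tested on
   all local sections of D. *)
Definition involutive (k : nat)
    (D : chart -> 'M[R]_(k.+1, m) -> {vspace 'M[R]_(k.+1, m)}) : Prop :=
  forall (U : set (set (R -> M)))
         (X Y : chart -> 'M[R]_(k.+1, m) -> 'M[R]_(k.+1, m)),
    open_jets k U -> vector_field U X -> vector_field U Y ->
    (forall c y, atlas c -> jlocal k U c y -> X c y \in D c y) ->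
    (forall c y, atlas c -> jlocal k U c y -> Y c y \in D c y) ->
    forall c y, atlas c -> jlocal k U c y -> bracket (X c) (Y c) y \in D c y.

End Jets.
Arguments slit_jets {R m} M k.
Arguments jlocal {R m M} k U c.
Arguments local_fun {R m M} k f c _.
Arguments jtrans {R m M} k c c' _.

(* Coordinate operations. A 1-form with respect to the coordinates (y^i_r) is
   represented by the function y |-> w y, where w y r i is the coefficient of
   dy^i_r at y. *)
Section Coordinates.
Context {R : realType} {m : nat}.
Local Notation coords k := ('M[R]_(k.+1, m)).

(* The projection tau_(k, j), for j <= k. *)
Definition trunc (k j : nat) (y : coords k) : coords j :=
  \matrix_(r, i) y (inord r) i.

(* The pull-back of a 1-form by tau_(k, j), for j <= k. *)
Definition pullback (j k : nat) (w : coords j -> coords j) :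
    coords k -> coords k :=
  fun y => \matrix_(s, i) if (s <= j)%N then w (trunc j y) (inord s) i else 0.

(* The canonical field Delta^r, for 1 <= r <= k. The falling factorial s ^_ r
   is s!/(s-r)! if r <= s and 0 if s < r. *)
Definition Delta (k r : nat) (y : coords k) : coords k :=
  \matrix_(s, i) ((s ^_ r)%:R * y (inord (s.+1 - r)) i).

Definition dfun (k : nat) (f : coords k -> R) : coords k -> coords k :=
  fun y => \matrix_(r, i) 'D_(delta_mx r i) f y.

(* S (dy^i_r) = r dy^i_(r-1). *)
Definition vertS (k : nat) (w : coords k -> coords k) : coords k -> coords k :=
  fun y => \matrix_(s, i)
    if (s < k)%N then s.+1%:R * w y (inord s.+1) i else 0.

Definition dT_fun (k : nat) (f : coords k -> R) : coords k.+1 -> R :=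
  fun y => \sum_(r < k.+1) \sum_(i < m)
    y (inord r.+1) i * 'D_(delta_mx r i) f (trunc k y).

(* d_T (w_s dy_s) = (d_T w_s) dy_s + w_s dy_(s+1). *)
Definition dT_form (k : nat) (w : coords k -> coords k) :
    coords k.+1 -> coords k.+1 :=
  fun y => \matrix_(s, i)
    ((if (s <= k)%N then dT_fun (fun z => w z (inord s) i) y else 0) +
     (if (0 < s)%N then w (trunc k y) (inord s.-1) i else 0)).

Fixpoint dT_iter (p k : nat) (w : coords k -> coords k) :
    coords (p + k) -> coords (p + k) :=
  match p return coords (p + k) -> coords (p + k) with
  | 0 => w
  | p'.+1 => dT_form (@dT_iter p' k w)
  end.

(* The Hilbert form on T^(2n-1) of a Lagrangian with coordinate expression
   L. *)
Definition hilbert_form (n : nat) (L : coords n -> R) :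
    coords n.*2.-1 -> coords n.*2.-1 :=
  fun y => \sum_(p < n) ((-1) ^+ p / (p.+1)`!%:R) *:
    pullback (@dT_iter p n (iter p.+1 (@vertS n) (dfun L))) y.

Definition pairing (k : nat) (w xi : coords k) : R :=
  \sum_(r < k.+1) \sum_(i < m) w r i * xi r i.

(* dw (xi, eta) = xi (w (eta)) - eta (w (xi)) for constant xi and eta. *)
Definition ext_d (k : nat) (w : coords k -> coords k) (y xi eta : coords k) :
    R :=
  'D_xi (fun z => pairing (w z) eta) y - 'D_eta (fun z => pairing (w z) xi) y.

Definition ker_d (k : nat) (w : coords k -> coords k) (y : coords k) :
    set (coords k) :=
  [set xi | forall eta, ext_d w y xi eta = 0].

End Coordinates.

Section Main.
Context {R : realType} {m : nat} (M : manifold R m).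

(* Only the values of L on T^n_o M matter. *)
Definition lagrangian (n : nat) (L : set (R -> M) -> R) : Prop :=
  forall c, atlas c ->
    smooth_on (jlocal n (slit_jets M n) c) (local_fun n L c).

Definition zermelo (n : nat) (L : set (R -> M) -> R) : Prop :=
  forall c y, atlas c -> jlocal n (slit_jets M n) c y ->
    'D_(Delta 1 y) (local_fun n L c) y = local_fun n L c y /\
    forall r, (2 <= r <= n)%N ->
      'D_(Delta r y) (local_fun n L c) y = 0.

Definition parametric_lagrangian (n : nat) (L : set (R -> M) -> R) : Prop :=
  lagrangian n L /\ zermelo n L.

Definition regular (n : nat) (L : set (R -> M) -> R) : Prop :=
  forall c y, atlas c ->
    jlocal n.*2.-1 (slit_jets M n.*2.-1) c y ->
    exists K : {vspace 'M[R]_(n.*2.-1.+1, m)},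
      \dim K = n.*2 /\
      [set` K] = ker_d (hilbert_form (local_fun n L c)) y.

Definition diff_eq_field (k : nat)
    (G : chart R m M -> 'M[R]_(k.+1, m) -> 'M[R]_(k.+1, m)) : Prop :=
  vector_field (slit_jets M k) G /\
  forall c y, atlas c -> jlocal k (slit_jets M k) c y ->
    forall r i, (r < k)%N -> G c y (inord r) i = y (inord r.+1) i.

Definition homogeneous (k : nat)
    (G : chart R m M -> 'M[R]_(k.+1, m) -> 'M[R]_(k.+1, m)) : Prop :=
  involutive (fun c y => <<G c y :: [seq Delta r y | r <- iota 1 k]>>%VS).

Definition euler_lagrange_field (n : nat) (L : set (R -> M) -> R)
    (G : chart R m M -> 'M[R]_(n.*2.-1.+1, m) -> 'M[R]_(n.*2.-1.+1, m)) :
    Prop :=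
  diff_eq_field G /\
  forall c y, atlas c ->
    jlocal n.*2.-1 (slit_jets M n.*2.-1) c y ->
    ker_d (hilbert_form (local_fun n L c)) y (G c y).

End Main.

(* Main.v *)
(* Let theta be the Hilbert form. With S the vertical endomorphism one has
   S d_T = d_T S + 1, so the sum defining theta telescopes to
   S (d_T theta) = S dL: the components of theta of index s - 1 and s satisfy
   theta_(s-1) + d_T theta_s = dL/dy_s. Descending recursion on s, using the
   Zermelo conditions and [Delta^r, d_T] = r Delta^(r-1), then gives
   Lie_(Delta^r) theta = 0 and theta(Delta^r) = 0, hence Delta^r lies in
   ker d(theta), for every r >= 1. At a jet with nonzero velocity the fields
   Gamma, Delta^1, ..., Delta^(2n-1) are linearly independent, so by regularity
   they span ker d(theta), and the kernel of a closed 2-form is involutive. *)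
Require Import Defs.
From HB Require Import structures.
From mathcomp Require Import all_boot all_order all_algebra.
From mathcomp Require Import all_classical all_reals all_analysis.
From mathcomp Require Import ring lra zify.

Set Implicit Arguments.
Unset Strict Implicit.
Unset Printing Implicit Defensive.

Import Order.TTheory GRing.Theory Num.Theory.
Import numFieldNormedType.Exports.

Local Open Scope classical_set_scope.
Local Open Scope ring_scope.

(** * Directional derivatives and the symmetry of second derivatives *)

(** In coordinates each [Delta r] is a linear vector field, its own differential, so brackets are
    commutators of linear maps; the symmetry of second derivatives supplies the rest, including d d
    = 0. The obstacle is that d_T raises the order of jets. Everything is therefore pulled back to
    order k = 2n-1, where d_T becomes the derivative along the linear field [canon 0], with 0 in
    place of the missing y_(k+1). The commutation rules then hold only up to a vector in the top
    row. Such errors are harmless for two reasons: the Hilbert form has no component of index at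
    least n, so it pairs to 0 with them; and its component of index s involves only coordinates of
    order at most 2n-1-s, so for s >= 1 its derivative along them is 0. The vanishing from index n
    on also starts the descending recursions. *)

Section LocalCalculus.
Context {R : realType} {V W : normedModType R}.

Lemma eq_open_near (U : set V) (f g : V -> W) (x : V) :
  open U -> U x -> (forall y, U y -> f y = g y) -> \forall y \near x, f y = g y.
Proof.
by move=> oU Ux fg; apply: filterS (open_nbhs_nbhs (conj oU Ux)) => y /fg.
Qed.

Lemma eq_derive_open (U : set V) (f g : V -> W) (x v : V) :
  open U -> U x -> (forall y, U y -> f y = g y) -> 'D_v f x = 'D_v g x.
Proof. by move=> oU Ux fg; apply: near_eq_derive; exact: eq_open_near oU Ux fg. Qed.

Lemma eq_differentiable_open (U : set V) (f g : V -> W) (x : V) :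
  open U -> U x -> (forall y, U y -> f y = g y) ->
  differentiable f x -> differentiable g x.
Proof.
move=> oU Ux fg df; have fgx := fg x Ux.
have /diff_locallyP[cdf /eqaddoP fo] := df.
have go : g \o shift x = cst (g x) + 'd f x +o_ (0 : V) id.
  apply/eqaddoP => e e0; have := fo e e0; apply: filter_app.
  have : \forall h \near (0 : V), f (h + x) = g (h + x).
    by have := eq_open_near oU Ux fg; rewrite (near_shift 0) /= subr0.
  by apply: filterS => h hE; rewrite /= !fctE /= hE fgx.
by apply/diff_locallyP; rewrite (diff_unique cdf go).
Qed.

Lemma is_derive_line (f : V -> W) (v b : V) (t : R) :
  differentiable f (t *: v + b) ->
  is_derive t 1 (fun s : R => f (s *: v + b)) ('D_v f (t *: v + b)).
Proof.
move=> df.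
have dl : is_diff t (fun s : R => s *: v + b) (fun s => s *: v).
  by apply: is_diff_eq; rewrite addr0.
have dc := @differentiable_comp _ _ _ _ (fun s : R => s *: v + b) f t
  (@ex_diff _ _ _ _ _ _ _ dl) df.
apply: DeriveDef; first exact/diff_derivable.
rewrite deriveE// (diff_comp (@ex_diff _ _ _ _ _ _ _ dl) df)//= deriveE//.
by rewrite (@diff_val _ _ _ _ _ _ _ dl) scale1r.
Qed.

End LocalCalculus.

Section Schwarz.
Context {R : realType} {V : normedModType R}.

Let increment_estimate (a b s p q c h e : R) : 0 < h ->
  `|a - s - (c * p + h * q)| <= e / 2 * h -> `|b - s - c * p| <= e / 2 * h ->
  `|(a - b) * h - h ^+ 2 * q| <= e * h ^+ 2.
Proof.
move=> h0 H1 H2; have -> : (a - b) * h - h ^+ 2 * q = h * (a - b - h * q) by ring.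
rewrite normrM (gtr0_norm h0) expr2 mulrCA ler_wpM2l ?(ltW h0)//.
move: H1 H2; move: (c * p) (h * q) (e * h) (mulrAC e 2^-1 h) => cp hq eh ->.
by rewrite !ler_norml => /andP[? ?] /andP[? ?]; apply/andP; split; lra.
Qed.

Let symmetric_estimate (a b c d k p q e : R) : 0 < k ->
  `|a - b - (c - d) - k * p| <= e / 2 * k ->
  `|a - c - (b - d) - k * q| <= e / 2 * k -> `|p - q| <= e.
Proof.
move=> k0 H1 H2; rewrite -(ler_pM2l k0) -{1}(gtr0_norm k0) -normrM mulrBr.
move: H1 H2; rewrite (mulrC k e).
move: (k * p) (k * q) (e * k) (mulrAC e 2^-1 k) => kp kq ek ->.
by rewrite !ler_norml => /andP[? ?] /andP[? ?]; apply/andP; split; lra.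
Qed.

(** The mean value theorem in direction v turns the second difference into h times a difference of
    two values of ['D_v f]; both are compared with the differential of ['D_v f] at x. *)
Lemma second_difference (U : set V) (f : V -> R) (x v w : V) :
  open U -> U x -> (forall y, U y -> differentiable f y) ->
  differentiable ('D_v f) x ->
  forall e : R, 0 < e -> \forall h \near (0 : R)^'+,
    `|f (h *: v + (h *: w + x)) - f (h *: w + x) - (f (h *: v + x) - f x)
      - h ^+ 2 * 'D_w ('D_v f) x| <= e * h ^+ 2.
Proof.
move=> oU Ux df ddf e e0.
(* [h * N] bounds every displacement a v + b w with a, b in [0, h], so the tolerance e / (2N) costs
   e/2 * h at each of the two points compared. The summand 1 keeps N positive. *)
pose N := `|v| + `|w| + 1.
have N0 : 0 < N by rewrite /N ltr_wpDl ?addr_ge0.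
have e'0 : 0 < e / (2 * N) by rewrite divr_gt0// mulr_gt0.
have /diff_locallyP[_ /eqaddoP/(_ _ e'0)] := ddf.
move=> /nbhs_ballP[d1 /= d10 Hd1].
have [d2 /= d20 Hd2] : exists2 d : R, 0 < d & ball x d `<=` U.
  by have /nbhs_ballP := open_nbhs_nbhs (conj oU Ux).
pose d := Num.min d1 d2.
have d0 : 0 < d by rewrite lt_min d10.
near=> h.
have h0 : 0 < h by near: h; exact: nbhs_right_gt.
have hN : h * N < d.
  rewrite -ltr_pdivlMr//; near: h; apply: nbhs_right_lt; exact: divr_gt0.
have small (a b : R) : 0 <= a <= h -> 0 <= b <= h -> `|a *: v + b *: w| <= h * N.
  move=> /andP[a0 ah] /andP[b0 bh]; apply: le_trans (ler_normD _ _) _.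
  rewrite !normrZ !ger0_norm// /N !mulrDr mulr1.
  by rewrite -[leLHS]addr0 lerD ?(ltW h0)// lerD// ler_wpM2r.
have inU (a b : R) : 0 <= a <= h -> 0 <= b <= h -> U (a *: v + (b *: w + x)).
  move=> ha hb; apply: Hd2; rewrite -ball_normE /= addrA opprD addrCA subrr addr0.
  rewrite normrN (le_lt_trans (small _ _ ha hb))// (lt_le_trans hN)//.
  by rewrite ge_min lexx orbT.
have est (a b : R) : 0 <= a <= h -> 0 <= b <= h ->
    `|'D_v f (a *: v + (b *: w + x)) - 'D_v f x
      - (a * 'D_v ('D_v f) x + b * 'D_w ('D_v f) x)| <= e / 2 * h.
  move=> ha hb; have := small _ _ ha hb => sm.
  have := Hd1 (a *: v + b *: w); rewrite -ball_normE /= sub0r normrN.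
  move=> /(_ (le_lt_trans sm (lt_le_trans hN _))); rewrite ge_min lexx => /(_ isT).
  have dE : 'd ('D_v f) x (a *: v + b *: w)
      = a * 'D_v ('D_v f) x + b * 'D_w ('D_v f) x.
    by rewrite !deriveE// linearD !linearZ.
  rewrite !fctE /= dE opprD addrA => H; rewrite (addrA (a *: v)).
  apply: le_trans H _; apply: le_trans (ler_wpM2l (ltW e'0) sm) _.
  by rewrite le_eqVlt; apply/orP; left; apply/eqP; field; rewrite gt_eqF.
pose phi t := f (t *: v + (h *: w + x)) - f (t *: v + x).
have in0 (a : R) : 0 <= a <= h -> U (a *: v + x).
  by move=> ha; have := inU a 0 ha; rewrite scale0r add0r lexx (ltW h0); apply.
have hh : 0 <= h <= h by rewrite lexx ltW.
have dphi (t : R) : 0 <= t <= h -> is_derive t 1 phi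
    ('D_v f (t *: v + (h *: w + x)) - 'D_v f (t *: v + x)).
  move=> ht; apply: is_deriveB; apply: is_derive_line; apply: df.
    exact: inU.
  exact: in0.
have [|c|c] := @MVT R phi
    (fun t => 'D_v f (t *: v + (h *: w + x)) - 'D_v f (t *: v + x)) 0 h h0.
- by move=> t /[!in_itv]/= /andP[t0 th]; apply: dphi; rewrite !ltW.
- apply: derivable_within_continuous => t /[!in_itv]/= th.
  by have [] := dphi t th.
move=> /[!in_itv]/= /andP[c0 ch]; rewrite subr0 /phi !scale0r !add0r => fE.
have {fE} -> : f (h *: v + (h *: w + x)) - f (h *: w + x)
    - (f (h *: v + x) - f x)
  = ('D_v f (c *: v + (h *: w + x)) - 'D_v f (c *: v + x)) * h by rewrite -fE; ring.
have hc : 0 <= c <= h by rewrite !ltW.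
have E1 := est c h hc hh.
have := est c 0 hc; rewrite lexx (ltW h0) => /(_ isT) E2.
rewrite scale0r add0r mul0r addr0 in E2.
exact: increment_estimate h0 E1 E2.
Unshelve. all: by end_near. Qed.

(** The second difference is symmetric in v and w, so after division by h^2 both mixed derivatives
    approximate the same quantity. *)
Lemma derive_comm (U : set V) (f : V -> R) (x v w : V) :
  open U -> U x -> (forall y, U y -> differentiable f y) ->
  differentiable ('D_v f) x -> differentiable ('D_w f) x ->
  'D_w ('D_v f) x = 'D_v ('D_w f) x.
Proof.
move=> oU Ux df dv dw; apply/eqP; rewrite -subr_eq0 -normr_le0.
apply/ler_addgt0Pr => e e0; rewrite add0r.
have e20 : 0 < e / 2 by rewrite divr_gt0.
have S1 := @second_difference U f x v w oU Ux df dv _ e20.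
have S2 := @second_difference U f x w v oU Ux df dw _ e20.
near (0 : R)^'+ => h.
have h0 : 0 < h by near: h; exact: nbhs_right_gt.
have H1 := near S1 h; have H2 := near S2 h.
have h20 : 0 < h ^+ 2 by rewrite exprn_gt0.
rewrite (addrCA (h *: w)) in H2; exact: symmetric_estimate h20 (H1 _) (H2 _).
Unshelve. all: by end_near. Qed.

End Schwarz.

(** * Smooth functions on open sets *)

Section SmoothCalculus.
Context {R : realType} {V W : normedModType R}.
Implicit Types (U : set V) (f g : V -> W).

(** Smoothness cut at finite depth, so that closure under sums and products can be proved by
    induction on the number of derivatives instead of on lists of directions. *)
Fixpoint diffn (n : nat) (U : set V) (f : V -> W) : Prop :=
  (forall x, U x -> differentiable f x) /\
  (if n is n'.+1 then forall v, diffn n' U ('D_v f) else True).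

Lemma diffn_diff n U f x : diffn n U f -> U x -> differentiable f x.
Proof. by case: n => [|n] [+ _]; apply. Qed.

Lemma diffnW n U f : diffn n.+1 U f -> diffn n U f.
Proof.
elim: n f => [|n IH] f [df dvf]; first by split.
by split=> // v; exact: IH (dvf v).
Qed.

Lemma smooth_onP U f : smooth_on U f <-> forall n, diffn n U f.
Proof.
split=> [sf n|dn vs].
  elim: n f sf => [|n IH] f sf; split=> [x|]; try exact: (sf [::]).
    by [].

  (* [foldr] differentiates along the last direction of the list first, hence [rcons]. *)
  by move=> v; apply: IH => vs x Ux; have := sf (rcons vs v) x Ux; rewrite foldr_rcons.
elim/last_ind: vs f dn => [|vs v IH] f dn x Ux; first exact: (diffn_diff (dn 0%N) Ux).
by rewrite foldr_rcons; apply: IH => // n; have [_] := dn n.+1; apply.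
Qed.

Lemma smooth_on_diff U f x : smooth_on U f -> U x -> differentiable f x.
Proof. by move=> /(_ [::] x). Qed.

Lemma smooth_on_derive U f v : smooth_on U f -> smooth_on U ('D_v f).
Proof. by move=> /smooth_onP sf; apply/smooth_onP => n; have [_] := sf n.+1; apply. Qed.

Lemma smooth_on_sub U U' f : U' `<=` U -> smooth_on U f -> smooth_on U' f.
Proof. by move=> sU sf vs x /sU; exact: sf. Qed.

Lemma eq_diffn n U f g : open U -> (forall x, U x -> f x = g x) ->
  diffn n U f -> diffn n U g.
Proof.
move=> oU; elim: n f g => [|n IH] f g fg [df dvf];
  (split; first by move=> x Ux; exact: eq_differentiable_open oU Ux fg (df x Ux)) => //.
by move=> v; apply: IH (dvf v) => x Ux; exact: eq_derive_open oU Ux fg.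
Qed.

Lemma eq_smooth_on U f g : open U -> (forall x, U x -> f x = g x) ->
  smooth_on U f -> smooth_on U g.
Proof.
move=> oU fg /smooth_onP sf; apply/smooth_onP => n; exact: eq_diffn oU fg (sf n).
Qed.

Lemma smooth_on_cst U (w : W) : open U -> smooth_on U (fun=> w).
Proof.
move=> oU; apply/smooth_onP => n; elim: n w => [|n IH] w; (split => //).
move=> v; apply: eq_diffn (IH 0) => // x _.
by rewrite -[RHS]/('D_v (cst w) x) derive_cst.
Qed.

Lemma diffnD n U f g : open U -> diffn n U f -> diffn n U g ->
  diffn n U (fun x => f x + g x).
Proof.
move=> oU.
have dD n' f' g' x : diffn n' U f' -> diffn n' U g' -> U x ->
    differentiable (f' + g') x.
  by move=> df dg Ux; apply: differentiableD;
    [apply: diffn_diff df Ux|apply: diffn_diff dg Ux].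
elim: n f g => [|n IH] f g df dg; split => //; try by move=> x; exact: dD df dg.
move=> v; apply: eq_diffn (IH _ _ (df.2 v) (dg.2 v)) => // x Ux.
rewrite -[RHS]/('D_v (f + g) x) deriveD//; apply: diff_derivable.
  exact: diffn_diff df Ux.
exact: diffn_diff dg Ux.
Qed.

Lemma smooth_onD U f g : open U -> smooth_on U f -> smooth_on U g ->
  smooth_on U (fun x => f x + g x).
Proof.
by move=> oU /smooth_onP df /smooth_onP dg; apply/smooth_onP => n; exact: diffnD.
Qed.

Lemma smooth_onZ U (k : R) f : open U -> smooth_on U f ->
  smooth_on U (fun x => k *: f x).
Proof.
move=> oU /smooth_onP sf; apply/smooth_onP => n.
have {}sf := sf n; elim: n f sf => [|n IH] f sf; split => //.
- by move=> x Ux; apply: differentiableZ; apply: diffn_diff sf Ux.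
- by move=> x Ux; apply: differentiableZ; apply: diffn_diff sf Ux.
- move=> v; apply: eq_diffn (IH _ (sf.2 v)) => // x Ux.
  rewrite -[RHS]/('D_v (k *: f) x) deriveZ//; apply: diff_derivable.
  exact: diffn_diff sf Ux.
Qed.

Lemma smooth_on_sum (I : Type) (r : seq I) (P : pred I) U (F : I -> V -> W) :
  open U -> (forall i, P i -> smooth_on U (F i)) ->
  smooth_on U (fun x => \sum_(i <- r | P i) F i x).
Proof.
move=> oU sF; elim: r => [|i r IH].
  by apply: (@eq_smooth_on U (fun=> 0)) (smooth_on_cst 0 oU) => // x _; rewrite big_nil.
have [Pi|nPi] := boolP (P i).
  apply: eq_smooth_on (smooth_onD oU (sF i Pi) IH) => // x _.
  by rewrite big_cons Pi.
by apply: eq_smooth_on IH => // x _; rewrite big_cons (negbTE nPi).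
Qed.

End SmoothCalculus.

Section SmoothScalar.
Context {R : realType} {V : normedModType R}.
Implicit Types (U : set V).

Lemma smooth_onM U (f g : V -> R) : open U -> smooth_on U f -> smooth_on U g ->
  smooth_on U (fun x => f x * g x).
Proof.
move=> oU /smooth_onP sf /smooth_onP sg; apply/smooth_onP => n.
have dM n' (f' g' : V -> R) x : diffn n' U f' -> diffn n' U g' -> U x ->
    differentiable (f' * g') x.
  by move=> df dg Ux; apply: differentiableM;
    [apply: diffn_diff df Ux|apply: diffn_diff dg Ux].
have {}sf := sf n; have {}sg := sg n.
elim: n f g sf sg => [|n IH] f g sf sg; split => //;
  try by move=> x; exact: dM sf sg.
move=> v; apply: eq_diffn (diffnD oU (IH _ _ (diffnW sf) (sg.2 v))
                             (IH _ _ (diffnW sg) (sf.2 v))) => // x Ux.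
rewrite -[RHS]/('D_v (f * g) x) deriveM//; apply: diff_derivable.
  exact: diffn_diff sf Ux.
exact: diffn_diff sg Ux.
Qed.

Lemma smooth_onZl (W : normedModType R) U (k : V -> R) (w : W) :
  open U -> smooth_on U k -> smooth_on U (fun x => k x *: w).
Proof.
move=> oU /smooth_onP sk; apply/smooth_onP => n.
have {}sk := sk n; elim: n k sk => [|n IH] k sk; split => //.
- by move=> x Ux; apply: differentiableZl; apply: diffn_diff sk Ux.
- by move=> x Ux; apply: differentiableZl; apply: diffn_diff sk Ux.
- move=> v; apply: eq_diffn (IH _ (sk.2 v)) => // x Ux.
  have dk : differentiable k x by apply: diffn_diff sk Ux.
  by rewrite !deriveE ?diffZl//; exact: differentiableZl.
Qed.

End SmoothScalar.

Section MatrixCalculus.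
Context {R : realType} {p q : nat}.
Local Notation V := 'M[R]_(p, q).

Lemma mx_linear_differentiable (W : normedModType R) (f : {linear V -> W}) (y : V) :
  differentiable f y.
Proof.
have dF i j : differentiable (fun y : V => y i j *: f (delta_mx i j)) y.
  exact/differentiableZl/differentiable_coord.
have -> : (f : V -> W) =
    \sum_(i < p) \sum_(j < q) fun y : V => y i j *: f (delta_mx i j).
  apply/funext => z; rewrite fct_sumE.
  rewrite [in LHS](matrix_sum_delta z) raddf_sum; apply: eq_bigr => i _.
  by rewrite fct_sumE raddf_sum; apply: eq_bigr => j _; exact: linearZZ.
by apply: differentiable_sum => i; apply: differentiable_sum.
Qed.

Lemma derive_linear (W : normedModType R) (f : {linear V -> W}) (y v : V) :
  'D_v f y = f v.
Proof.
rewrite deriveE; last exact: mx_linear_differentiable.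
rewrite diff_lin// => x; apply: differentiable_continuous.
exact: mx_linear_differentiable.
Qed.

Lemma smooth_on_linear (W : normedModType R) (U : set V) (f : {linear V -> W}) :
  open U -> smooth_on U f.
Proof.
move=> oU; apply/smooth_onP => -[|n]; split => //;
  try by move=> x _; exact: mx_linear_differentiable.
move=> v; have /smooth_onP/(_ n) := smooth_on_cst (f v) oU.
by apply: eq_diffn => // x _; rewrite derive_linear.
Qed.

Definition mx_coord (i : 'I_p) (j : 'I_q) : V -> R := fun y => y i j.

Lemma mx_coord_is_linear i j : linear (mx_coord i j).
Proof. by move=> a u v; rewrite /mx_coord !mxE. Qed.

HB.instance Definition _ i j :=
  GRing.isLinear.Build R V R *%R (mx_coord i j) (mx_coord_is_linear i j).

Lemma derive_coord_sum (W : normedModType R) (f : V -> W) (y v : V) :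
  differentiable f y ->
  'D_v f y = \sum_(i < p) \sum_(j < q) v i j *: 'D_(delta_mx i j) f y.
Proof.
move=> df; rewrite !deriveE// {1}(matrix_sum_delta v) raddf_sum.
apply: eq_bigr => i _; rewrite raddf_sum; apply: eq_bigr => j _.
by rewrite deriveE//; exact: linearZZ.
Qed.

Lemma smooth_on_field (U : set V) (A : {linear V -> V}) (f : V -> R) :
  open U -> smooth_on U f -> smooth_on U (fun y => 'D_(A y) f y).
Proof.
move=> oU sf; apply: (@eq_smooth_on _ _ _ U (fun y => \sum_(i < p) \sum_(j < q)
    (mx_coord i j \o A) y * 'D_(delta_mx i j) f y)) => //.
  by move=> y Uy; rewrite (derive_coord_sum _ (smooth_on_diff sf Uy)).
apply: smooth_on_sum => // i _; apply: smooth_on_sum => // j _.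
apply: smooth_onM => //; [exact: smooth_on_linear|exact: smooth_on_derive].
Qed.

(** Product rule on the coordinate expansion of ['D_(Z z) f]: one half differentiates the
    coefficients of Z, the other contains mixed second derivatives of f, which are then
    exchanged. *)
Lemma derive_field (U : set V) (Z : V -> V) (f : V -> R) (y v : V) :
  open U -> U y -> smooth_on U f -> differentiable Z y ->
  'D_v (fun z => 'D_(Z z) f z) y = 'D_(Z y) ('D_v f) y + 'D_('D_v Z y) f y.
Proof.
move=> oU Uy sf dZ.
have dfs w : differentiable ('D_w f) y := smooth_on_diff (smooth_on_derive w sf) Uy.
have dZij i j : differentiable (fun z => Z z i j) y.
  apply: (@differentiable_comp _ _ _ _ Z (fun N : V => N i j : R)) => //.
  exact: differentiable_coord.
rewrite (@eq_derive_open _ _ _ U _ (\sum_(i < p) \sum_(j < q)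
    (fun z => Z z i j) * 'D_(delta_mx i j) f)) //; last first.
  move=> z Uz; rewrite (derive_coord_sum _ (smooth_on_diff sf Uz)).
  by rewrite fct_sumE; apply: eq_bigr => i _; rewrite fct_sumE.
rewrite derive_sum; last first.
  move=> i; apply: derivable_sum => j; apply: diff_derivable.
  exact: differentiableM.
rewrite !(derive_coord_sum _ (dfs _)) (derive_coord_sum _ (smooth_on_diff sf Uy)).
rewrite -big_split; apply: eq_bigr => i _ /=.
rewrite derive_sum; last first.
  by move=> j; apply: diff_derivable; exact: differentiableM.
rewrite -big_split; apply: eq_bigr => j _ /=.
rewrite deriveM; [|exact: diff_derivable..].
rewrite (@derive_comm _ _ U f y (delta_mx i j) v)//; last first.
  by move=> z Uz; exact: smooth_on_diff sf Uz.
congr (_ + _); rewrite /GRing.scale /= mulrC; congr (_ * _).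
by rewrite derive_mx ?mxE//; exact: diff_derivable.
Qed.

Lemma derive_linear_field (U : set V) (A : {linear V -> V}) (f : V -> R) (y v : V) :
  open U -> U y -> smooth_on U f ->
  'D_v (fun z => 'D_(A z) f z) y = 'D_(A y) ('D_v f) y + 'D_(A v) f y.
Proof.
move=> oU Uy sf; rewrite (derive_field _ oU Uy sf) ?derive_linear//.
exact: mx_linear_differentiable.
Qed.

(** The second derivatives of f cancel by symmetry; what remains is the Lie bracket, for linear
    fields the commutator B A - A B. *)
Lemma linear_field_bracket (U : set V) (A B : {linear V -> V}) (f : V -> R) (y : V) :
  open U -> U y -> smooth_on U f ->
  'D_(A y) (fun z => 'D_(B z) f z) y - 'D_(B y) (fun z => 'D_(A z) f z) y =
  'D_(B (A y) - A (B y)) f y.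
Proof.
move=> oU Uy sf; rewrite (derive_linear_field B (A y) oU Uy sf).
rewrite (derive_linear_field A (B y) oU Uy sf).
have df := smooth_on_diff sf Uy.
rewrite (@derive_comm _ _ U f y (A y) (B y))//; first last.
- exact: smooth_on_diff (smooth_on_derive _ sf) Uy.
- exact: smooth_on_diff (smooth_on_derive _ sf) Uy.
- by move=> z Uz; exact: smooth_on_diff sf Uz.
by rewrite opprD addrACA subrr add0r !deriveE// linearB.
Qed.

End MatrixCalculus.

(** * The Hilbert form in coordinates *)

Section Pairing.
Context {R : realType} {m k : nat}.
Local Notation V := 'M[R]_(k.+1, m).
Implicit Types (w y eta : V).

(** For s > 0, the vectors vertical over the jets of order s - 1; [low_zero k] leaves only the top
    row, where the truncation errors live. *)
Definition low_zero (s : nat) (y : V) : Prop :=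
  forall (u : 'I_k.+1) i, (u < s)%N -> y u i = 0.

Lemma pairing_linear w : linear (pairing w).
Proof.
move=> a u v; rewrite /pairing /GRing.scale /= mulr_sumr -big_split.
apply: eq_bigr => r _; rewrite mulr_sumr -big_split; apply: eq_bigr => i _ /=.
by rewrite !mxE mulrDr mulrCA.
Qed.

HB.instance Definition _ w :=
  GRing.isLinear.Build R V R *%R (pairing w) (pairing_linear w).

Lemma pairing_delta w i j : pairing w (delta_mx i j) = w i j.
Proof.
rewrite /pairing (bigD1 i)//= (bigD1 j)//= mxE !eqxx mulr1.
rewrite big1 ?addr0 => [|j' /negbTE j'j]; last by rewrite mxE j'j andbF mulr0.
rewrite big1 ?addr0// => i' /negbTE i'i.
by rewrite big1// => j' _; rewrite mxE i'i mulr0.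
Qed.

Lemma pairing_low_zero n w eta :
  (forall (s : 'I_k.+1) i, (n <= s)%N -> w s i = 0) -> low_zero n eta ->
  pairing w eta = 0.
Proof.
move=> wn en; rewrite /pairing big1// => s _; rewrite big1// => i _.
by have [/wn->|/en->] := leqP n s; rewrite ?mul0r ?mulr0.
Qed.

Lemma derive_pairing (w B : V -> V) (y v : V) :
  (forall i j, differentiable (fun z => w z i j) y) -> differentiable B y ->
  'D_v (fun z => pairing (w z) (B z)) y =
  'D_v (fun z => pairing (w z) (B y)) y + pairing (w y) ('D_v B y).
Proof.
move=> dw dBy.
have dB i j : differentiable (fun z => B z i j) y.
  exact: (@differentiable_comp _ _ _ _ B (fun N : V => N i j : R) y dBy
    (differentiable_coord _ i j)).
have -> : (fun z => pairing (w z) (B z)) =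
    \sum_(i < k.+1) \sum_(j < m) (fun z => w z i j) * (fun z => B z i j).
  by apply/funext => z; rewrite fct_sumE; apply: eq_bigr => i _; rewrite fct_sumE.
have -> : (fun z => pairing (w z) (B y)) =
    \sum_(i < k.+1) \sum_(j < m) (fun z => w z i j) * cst (B y i j).
  by apply/funext => z; rewrite fct_sumE; apply: eq_bigr => i _; rewrite fct_sumE.
have dwB i j v' : derivable ((fun z => w z i j) * (fun z => B z i j)) y v'.
  by apply: diff_derivable; exact: differentiableM.
have dwc i j c v' : derivable ((fun z => w z i j) * cst c) y v'.
  by apply: diff_derivable; apply: differentiableM.
rewrite !derive_sum; try by move=> i; exact: derivable_sum.
rewrite /pairing -big_split; apply: eq_bigr => i _ /=.
rewrite !derive_sum//.
rewrite -big_split; apply: eq_bigr => j _ /=.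
rewrite !deriveM; try exact: diff_derivable.
rewrite derive_cst scaler0 add0r addrC; congr (_ + _).
by rewrite (derive_mx (diff_derivable dBy)) mxE.
Qed.

End Pairing.

(** * The canonical fields and the truncated total derivative as linear maps *)

Section CanonicalFields.
Context {R : realType} {m k : nat}.
Local Notation V := 'M[R]_(k.+1, m).
Implicit Types (y eta : V).

Definition entry (y : V) (s : nat) (i : 'I_m) : R :=
  if (s <= k)%N then y (inord s) i else 0.

(* [canon r] is [Delta r] for [r >= 1], and the total derivative, truncated at
   order k, for [r = 0]. *)
Definition canon (r : nat) (y : V) : V :=
  \matrix_(s, i) ((s ^_ r)%:R * entry y (s.+1 - r) i).

(** A shift with two roles: on covectors it is dy_s -> dy_(s+1), the action of d_T on differentials;
    on vectors it is a right inverse of [canon 0] below the top row. *)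
Definition raise (y : V) : V :=
  \matrix_(s, i) if (0 < s)%N then y (inord s.-1) i else 0.

Lemma canon_is_linear r : linear (canon r).
Proof.
move=> a u v; apply/matrixP => s i; rewrite !mxE /entry.
by case: leqP => _; rewrite ?mxE ?mulr0 ?addr0// mulrDr mulrCA.
Qed.

HB.instance Definition _ r :=
  GRing.isLinear.Build R V V *:%R (canon r) (canon_is_linear r).

Lemma canon_Delta r y : (0 < r)%N -> canon r y = Delta r y.
Proof.
move=> r0; apply/matrixP => s i; rewrite !mxE /entry ifT//.
by have := ltn_ord s; lia.
Qed.

Lemma canon0E y (s : 'I_k.+1) i : canon 0 y s i = entry y s.+1 i.
Proof. by rewrite mxE ffactn0 mul1r subn0. Qed.

Lemma canon_low r y : low_zero r (canon r y).
Proof. by move=> s i sr; rewrite mxE ffact_small// mul0r. Qed.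

Lemma low_zero_canon r s y : (0 < r)%N -> low_zero s y -> low_zero s (canon r y).
Proof.
move=> r0 ys u i us; rewrite mxE; have [ur|ru] := ltnP u r.
  by rewrite ffact_small// mul0r.
by rewrite /entry; case: leqP => [uk|]; rewrite ?ys ?mulr0// inordK//; lia.
Qed.

Lemma low_zero_canon0 s y : low_zero s.+1 y -> low_zero s (canon 0 y).
Proof.
move=> ys u i us; rewrite canon0E /entry; case: leqP => // uk.
by rewrite ys// inordK.
Qed.

Lemma low_zero_raise s y : low_zero s y -> low_zero s.+1 (raise y).
Proof.
move=> ys u i us; rewrite mxE; case: ltnP => // u0; rewrite ys// inordK; first by lia.
by have := ltn_ord u; lia.
Qed.

Lemma low_zeroW s t y : (t <= s)%N -> low_zero s y -> low_zero t y.
Proof. by move=> ts ys u i ut; apply: ys; exact: (leq_trans ut ts). Qed.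

Lemma canon0_raise y : low_zero k (y - canon 0 (raise y)).
Proof.
move=> u i uk; rewrite !mxE /entry ffactn0 mul1r subn0 uk mxE inordK//=.
by rewrite inord_val subrr.
Qed.

(** Source of the factor r + 1 in the commutator of [canon 0] and [canon r.+1], whose coefficients
    are differences of falling factorials. *)
Lemma ffact_pascal (u r : nat) : (u.+1 ^_ r.+1 = u ^_ r.+1 + r.+1 * u ^_ r)%N.
Proof.
rewrite ffactSS ffactnSr; have [ur|ru] := ltnP u r.
  by rewrite ffact_small// !muln0 mul0n.
by rewrite [(r.+1 * _)%N]mulnC -mulnDr mulnC; congr (_ * _)%N; lia.
Qed.

(* The commutation rule [[Delta^r, d_T] = r Delta^(r-1)], exact below the top
   order because of the truncation. *)
Lemma canon_bracket r y :
  low_zero k (canon 0 (canon r.+1 y) - canon r.+1 (canon 0 y)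
              - r.+1%:R *: canon r y).
Proof.
move=> u i uk.
have -> : (canon 0 (canon r.+1 y) - canon r.+1 (canon 0 y) - r.+1%:R *: canon r y) u i
  = canon 0 (canon r.+1 y) u i - canon r.+1 (canon 0 y) u i - r.+1%:R * canon r y u i.
  by rewrite !mxE.
rewrite canon0E {1}/entry uk 3!mxE inordK// subSS.
have -> : (u ^_ r.+1)%:R * entry (canon 0 y) (u.+1 - r.+1) i
        = (u ^_ r.+1)%:R * entry y (u.+1 - r) i.
  have [ur|ru] := ltnP u r.+1; first by rewrite ffact_small// !mul0r.
  have uk' : (u.+1 - r.+1 < k.+1)%N by lia.
  rewrite {1}/entry -ltnS uk' canon0E inordK//.
  by have -> : (u.+1 - r = (u.+1 - r.+1).+1)%N by lia.
rewrite ffact_pascal natrD natrM; ring.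
Qed.

End CanonicalFields.

(** * Canonical fields in the kernel, derived from the first variation formula *)

Section HilbertForm.
Context {R : realType} {m k n : nat}.
Local Notation V := 'M[R]_(k.+1, m).
Variables (U : set V) (L : V -> R) (w : V -> V).
Hypotheses (oU : open U) (nk : (n <= k)%N) (n2k : (n.*2 <= k.+1)%N).
Hypothesis smL : smooth_on U L.
Hypothesis smw : forall eta, smooth_on U (fun z => pairing (w z) eta).
Hypothesis w0 : forall y, U y -> forall (s : 'I_k.+1) i, (n <= s)%N -> w y s i = 0.
Hypothesis first_variation : forall y eta, U y -> low_zero 1 eta ->
  pairing (w y) (canon 0 eta) =
  'D_eta L y - 'D_(canon 0 y) (fun z => pairing (w z) eta) y.
Hypothesis L_low : forall y zeta, U y -> low_zero n.+1 zeta -> 'D_zeta L y = 0.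
Hypothesis zermeloL : forall y r, U y ->
  'D_(canon r.+1 y) L y = (r == 0)%N%:R * L y.

Let pair0 eta y : low_zero n eta -> U y -> pairing (w y) eta = 0.
Proof. by move=> en Uy; exact: pairing_low_zero (w0 Uy) en. Qed.

Let pair_congr eta eta' y : low_zero k (eta - eta') -> U y ->
  pairing (w y) eta = pairing (w y) eta'.
Proof.
move=> ek Uy; apply/eqP; rewrite -subr_eq0 -linearB /=; apply/eqP.
exact: pair0 (low_zeroW nk ek) Uy.
Qed.

Let derive_pair0 eta y zeta : low_zero n eta -> U y ->
  'D_zeta (fun z => pairing (w z) eta) y = 0.
Proof.
move=> en Uy; rewrite (@eq_derive_open _ _ _ U _ (cst 0)) ?derive_cst//.
by move=> z Uz; exact: pair0 en Uz.
Qed.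

(** The step of the descending recursions: if eta starts in row s then [raise eta] starts in row s +
    1, so components of w are expressed through L and components of higher index. *)
Let pair_raise eta y : U y -> low_zero 0 eta ->
  pairing (w y) eta =
  'D_(raise eta) L y - 'D_(canon 0 y) (fun z => pairing (w z) (raise eta)) y.
Proof.
move=> Uy e0; rewrite (pair_congr (canon0_raise eta) Uy).
by apply: first_variation => //; exact: low_zero_raise.
Qed.

Let derivable_DL v v' y : U y -> derivable ('D_v L) y v'.
Proof.
move=> Uy; apply: diff_derivable.
exact: smooth_on_diff (smooth_on_derive v smL) Uy.
Qed.

Let derivable_Tw r eta v y : U y ->
  derivable (fun z => 'D_(canon r z) (fun x => pairing (w x) eta) z) y v.
Proof.
move=> Uy; apply: diff_derivable.
exact: smooth_on_diff (smooth_on_field (canon r) oU (smw eta)) Uy.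
Qed.

Let derive_pair_raise v eta y : U y ->
  'D_v (fun z => pairing (w z) eta) y =
  'D_v ('D_(raise eta) L) y
  - 'D_v (fun z => 'D_(canon 0 z) (fun x => pairing (w x) (raise eta)) z) y.
Proof.
move=> Uy; rewrite -deriveB; [|exact: derivable_DL|exact: derivable_Tw].
by apply: (eq_derive_open v oU Uy) => z Uz; rewrite pair_raise.
Qed.

Let derive_L_comm v v' y : U y -> 'D_v ('D_v' L) y = 'D_v' ('D_v L) y.
Proof.
move=> Uy; apply: (derive_comm oU Uy).
- by move=> z Uz; exact: smooth_on_diff smL Uz.
- exact: smooth_on_diff (smooth_on_derive _ smL) Uy.
- exact: smooth_on_diff (smooth_on_derive _ smL) Uy.
Qed.

(* The momenta w_s depend only on the coordinates of order at most 2n-1-s. *)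
Lemma derive_momentum s j zeta eta y : (n.*2 <= s + j)%N ->
  low_zero j zeta -> low_zero s eta -> U y ->
  'D_zeta (fun z => pairing (w z) eta) y = 0.
Proof.
have [d] := ubnP (n - s); elim: d s j zeta eta y => // d IH s j zeta eta y.
move=> nsd nsj zj es Uy; have [ns|sn] := leqP n s.
  by rewrite derive_pair0//; exact: low_zeroW ns es.
rewrite derive_pair_raise//.
have jn : (n < j)%N by lia.
have IHs := IH s.+1; rewrite derive_L_comm//.
rewrite (@eq_derive_open _ _ _ U _ (cst 0)) ?derive_cst//; last first.
  by move=> z Uz; apply: L_low => //; exact: low_zeroW jn zj.
rewrite (derive_linear_field (canon 0) _ oU Uy (smw _)) sub0r.
rewrite (@eq_derive_open _ _ _ U _ (cst 0)) ?derive_cst ?add0r//; last first.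
  move=> z Uz; apply: (IHs j) => //; [by lia|by lia|exact: low_zero_raise].
(* Differentiating the field [canon 0] along zeta lowers j by one, but [raise] has increased s by
   one, so the bound 2n on the sum is kept. *)
rewrite (IHs j.-1) ?oppr0//; [by lia|by lia| |exact: low_zero_raise].
by apply: low_zero_canon0; rewrite prednK//; lia.
Qed.

(** This is Lie_(Delta^(r+1)) w = 0 on the constant vector eta: the right-hand side is the term with
    the differential of the field, which by linearity is the field itself. The recursion runs on the
    first row in which eta may be nonzero. *)
Lemma Lie_canon r eta y : U y ->
  'D_(canon r.+1 y) (fun z => pairing (w z) eta) y =
  - pairing (w y) (canon r.+1 eta).
Proof.
have e0 : low_zero 0 eta by [].
have [d] := ubnP (n - 0); move: e0; move: 0%N => s.
elim: d s r eta y => // d IH s r eta y es nsd Uy; have [ns|sn] := leqP n s.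
  rewrite derive_pair0//; last exact: low_zeroW ns es.
  by rewrite pair0 ?oppr0//; apply: low_zero_canon => //; exact: low_zeroW ns es.
set eta' := raise eta; have e's : low_zero s.+1 eta' by exact: low_zero_raise.
have e'1 : low_zero 1 eta' by exact: low_zeroW e's.
have IHs r' z : U z -> 'D_(canon r'.+1 z) (fun x => pairing (w x) eta') z
    = - pairing (w z) (canon r'.+1 eta').
  by move=> Uz; apply: (IH s.+1) => //; lia.
have dg := smooth_on_diff (smw eta') Uy.
rewrite derive_pair_raise// -/eta'.
(* The Zermelo condition, differentiated along eta'. *)
have -> : 'D_(canon r.+1 y) ('D_eta' L) y =
    (r == 0)%N%:R * 'D_eta' L y - 'D_(canon r.+1 eta') L y.
  apply/eqP; rewrite eq_sym subr_eq.
  rewrite -(derive_linear_field (canon r.+1) eta' oU Uy smL); apply/eqP.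
  rewrite [RHS](@eq_derive_open _ _ _ U _ ((r == 0)%N%:R *: L) y eta' oU Uy).
    by rewrite deriveZ//; apply: diff_derivable; exact: smooth_on_diff smL Uy.
  by move=> z Uz; rewrite zermeloL.
have TE : 'D_(canon r.+1 y) (fun z => 'D_(canon 0 z) (fun x => pairing (w x) eta') z) y
  = 'D_(canon 0 y) (fun z => 'D_(canon r.+1 z) (fun x => pairing (w x) eta') z) y
    + r.+1%:R * 'D_(canon r y) (fun x => pairing (w x) eta') y.
  have br := linear_field_bracket (canon r.+1) (canon 0) oU Uy (smw eta').
  (* The truncation error sits in row k and eta' starts in row 1 or later, so [derive_momentum]
     kills it as soon as 2n <= k + 1; for k = 2n-1 this is an equality. *)
  have top := derive_momentum _ (canon_bracket r y) e'1 Uy.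
  rewrite add1n in top; have {}top := top n2k.
  have lin : 'D_(canon 0 (canon r.+1 y) - canon r.+1 (canon 0 y))
      (fun x => pairing (w x) eta') y
      = r.+1%:R * 'D_(canon r y) (fun x => pairing (w x) eta') y.
    move: top; rewrite (deriveE _ dg) linearB linearZ /= -!(deriveE _ dg).
    by move=> /eqP; rewrite subr_eq0 => /eqP.
  by move: br; rewrite lin => /eqP; rewrite subr_eq addrC => /eqP.
rewrite TE.
have -> : 'D_(canon 0 y) (fun z => 'D_(canon r.+1 z) (fun x => pairing (w x) eta') z) y
    = pairing (w y) (canon 0 (canon r.+1 eta')) - 'D_(canon r.+1 eta') L y.
  rewrite [LHS](@eq_derive_open _ _ _ U _
    (- (fun z => pairing (w z) (canon r.+1 eta'))) y (canon 0 y) oU Uy); last exact: IHs.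
  rewrite first_variation//; last exact: low_zeroW (@canon_low _ _ _ r.+1 eta').
  rewrite deriveN; last by apply: diff_derivable; exact: smooth_on_diff (smw _) Uy.
  by rewrite addrAC subrr add0r.
have -> : pairing (w y) (canon r.+1 eta) = pairing (w y) (canon r.+1 (canon 0 eta')).
  apply: pair_congr => //; rewrite -linearB; apply: low_zero_canon => //.
  exact: canon0_raise.
have := pair0 (low_zeroW nk (canon_bracket r eta')) Uy.
rewrite !linearB linearZ /=.
(* For r = 0 the commutator term is d_T itself and is evaluated by the first variation formula; for
   r > 0 it is a canonical field again and the recursion applies. *)
case: r {TE} => [|r].
  rewrite eqxx !mul1r.
  by have := first_variation Uy e'1; lra.
rewrite mul0r IHs//; lra.
Qed.

Let differentiable_w i j y : U y -> differentiable (fun z => w z i j) y.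
Proof.
move=> Uy; have -> : (fun z => w z i j) = (fun z => pairing (w z) (delta_mx i j)).
  by apply/funext => z; rewrite pairing_delta.
exact: smooth_on_diff (smw (delta_mx i j)) Uy.
Qed.

(** By recursion w(Delta^(r+2)) = 0, hence its derivative along d_T is 0 as well. The first
    variation formula for the vector Delta^(r+2), where Zermelo gives 0, turns this derivative into
    w paired with a commutator, that is, r + 2 times w(Delta^(r+1)). *)
Lemma pairing_canon r y : U y -> pairing (w y) (canon r.+1 y) = 0.
Proof.
have [d] := ubnP (n - r); elim: d r y => // d IH r y nrd Uy.
have [nr|rn] := leqP n r.+1.
  exact: pair0 (low_zeroW nr (@canon_low _ _ _ _ _)) Uy.
have := derive_pairing (canon 0 y) (fun i j => differentiable_w i j Uy)
  (mx_linear_differentiable (canon r.+2) y).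
rewrite (derive_linear (canon r.+2)).
rewrite (@eq_derive_open _ _ _ U _ (cst 0) y (canon 0 y) oU Uy) ?derive_cst;
  last first.
  by move=> z Uz; apply: IH => //; lia.
have := first_variation Uy (low_zeroW (isT : (1 <= r.+2)%N) (@canon_low _ _ _ r.+2 y)).
rewrite zermeloL// mul0r sub0r => /eqP; rewrite eq_sym eqr_oppLR => /eqP ->.
have := pair0 (low_zeroW nk (canon_bracket r.+1 y)) Uy.
rewrite !linearB linearZ /= => br cb.
have /eqP : r.+2%:R * pairing (w y) (canon r.+1 y) = 0 by lra.
by rewrite mulf_eq0 pnatr_eq0 => /eqP.
Qed.

(** Cartan's formula: i_Delta dw = Lie_Delta w - d(w(Delta)). *)
Lemma canon_ker r y : U y -> ker_d w y (canon r.+1 y).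
Proof.
move=> Uy eta; rewrite /ext_d Lie_canon//.
have := derive_pairing eta (fun i j => differentiable_w i j Uy)
  (mx_linear_differentiable (canon r.+1) y).
rewrite (derive_linear (canon r.+1)).
rewrite (@eq_derive_open _ _ _ U _ (cst 0) y eta oU Uy) ?derive_cst; last first.
  by move=> z Uz; exact: pairing_canon.
by move=> /eqP; rewrite eq_sym addr_eq0 => /eqP ->; rewrite opprK addNr.
Qed.

End HilbertForm.

Section SmoothMatrix.
Context {R : realType} {p q : nat}.
Local Notation V := 'M[R]_(p, q).

Lemma derive_linear_comp (V' W : normedModType R) p' q' (A : {linear 'M[R]_(p', q') -> W})
    (w : V' -> 'M[R]_(p', q')) (y v : V') :
  differentiable w y -> 'D_v (fun z => A (w z)) y = A ('D_v w y).
Proof.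
move=> dw; have dA := mx_linear_differentiable A (w y).
rewrite deriveE; last exact: (@differentiable_comp _ _ _ _ w A).
rewrite (diff_comp dw dA) /= diff_lin ?deriveE// => x.
apply: differentiable_continuous; exact: mx_linear_differentiable.
Qed.

Lemma smooth_on_linear_comp (V' W : normedModType R) p' q' (U : set V')
    (A : {linear 'M[R]_(p', q') -> W}) (w : V' -> 'M[R]_(p', q')) :
  open U -> smooth_on U w -> smooth_on U (fun z => A (w z)).
Proof.
move=> oU /smooth_onP sw; apply/smooth_onP => n.
have {}sw := sw n; elim: n w sw => [|n IH] w sw; split=> //;
  try by move=> x Ux; exact: (@differentiable_comp _ _ _ _ w A _ (diffn_diff sw Ux)
    (mx_linear_differentiable A _)).
move=> v; apply: eq_diffn (IH _ (sw.2 v)) => // x Ux.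
by rewrite derive_linear_comp//; exact: diffn_diff sw Ux.
Qed.

Lemma smooth_on_coord (V' : normedModType R) (U : set V') (w : V' -> V) i j :
  open U -> smooth_on U w -> smooth_on U (fun z => w z i j).
Proof. by move=> oU sw; exact: (smooth_on_linear_comp (mx_coord i j) oU sw). Qed.

Lemma smooth_on_mx (V' : normedModType R) (U : set V') (w : V' -> V) : open U ->
  (forall i j, smooth_on U (fun z => w z i j)) -> smooth_on U w.
Proof.
move=> oU sw.
apply: (@eq_smooth_on _ _ _ U (fun z => \sum_i \sum_j w z i j *: delta_mx i j)) => //.
  by move=> z _; rewrite -matrix_sum_delta.
apply: smooth_on_sum => // i _; apply: smooth_on_sum => // j _.
exact: smooth_onZl.
Qed.

Lemma smooth_on_field_mx (U : set V) (A : {linear V -> V}) (w : V -> V) :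
  open U -> smooth_on U w -> smooth_on U (fun y => 'D_(A y) w y).
Proof.
move=> oU sw; apply: smooth_on_mx => // i j.
apply: (@eq_smooth_on _ _ _ U (fun y => 'D_(A y) (fun z => w z i j) y)) => //.
  move=> z Uz; rewrite derive_mx ?mxE//.
  by apply: diff_derivable; exact: smooth_on_diff sw Uz.
by apply: smooth_on_field => //; exact: smooth_on_coord.
Qed.

End SmoothMatrix.

(** * Total derivative and vertical endomorphism on forms of fixed order *)

Section TotalDerivative.
Context {R : realType} {m k : nat}.
Local Notation V := 'M[R]_(k.+1, m).
Implicit Types (u eta y : V) (w : V -> V).

Lemma raise_is_linear : linear (@raise R m k).
Proof.
move=> a u v; apply/matrixP => s i; rewrite !mxE.
by case: ltnP => _; rewrite ?mulr0 ?addr0.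
Qed.

HB.instance Definition _ :=
  GRing.isLinear.Build R V V *:%R (@raise R m k) raise_is_linear.

Lemma pairingC u eta : pairing u eta = pairing eta u.
Proof. by apply: eq_bigr => s _; apply: eq_bigr => i _; rewrite mulrC. Qed.

Lemma pairing_raise u eta : pairing (raise u) eta = pairing u (canon 0 eta).
Proof.
have r0 : \sum_i raise u ord0 i * eta ord0 i = 0.
  by rewrite big1// => i _; rewrite [raise u ord0 i]mxE mul0r.
have rk : \sum_i u ord_max i * canon 0 eta ord_max i = 0.
  by rewrite big1// => i _; rewrite canon0E /entry /= ltnn mulr0.
rewrite /pairing [LHS]big_ord_recl [RHS]big_ord_recr /= r0 rk add0r addr0.
apply: eq_bigr => s _; apply: eq_bigr => i _.
rewrite canon0E /entry [raise u _ _]mxE /= ltn_ord.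
have sk := ltn_ord s.
by congr (u _ _ * eta _ _); apply: val_inj; rewrite /= inordK// /bump; lia.
Qed.

Definition vert u : V :=
  \matrix_(s, i) if (s < k)%N then s.+1%:R * u (inord s.+1) i else 0.

Lemma vert_is_linear : linear vert.
Proof.
move=> a u v; apply/matrixP => s i; rewrite !mxE.
by case: ltnP => _; rewrite ?mulr0 ?addr0// mulrDr mulrCA.
Qed.

HB.instance Definition _ :=
  GRing.isLinear.Build R V V *:%R vert vert_is_linear.

(** Pointwise core of S d_T = d_T S + 1: shifting before or after S gives u_s the weight s + 1 or s.
    The hypothesis excludes the component that [raise] would push out of range. *)
Lemma vert_raise u : (forall i, u ord_max i = 0) ->
  vert (raise u) = raise (vert u) + u.
Proof.
move=> uk; apply/matrixP => s i; rewrite mxE [RHS]mxE [raise _ s i]mxE; case: ltnP => sk.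
  rewrite mxE inordK//= inord_val; case: posnP => [->|s0]; first by rewrite mul1r add0r.
  rewrite mxE inordK; last by lia.
  rewrite prednK// ifT; last by lia.
  rewrite inord_val; have -> : s.+1%:R = s%:R + 1 :> R by rewrite -natr1.
  by rewrite mulrDl mul1r.
have se : s = ord_max by apply/val_inj => /=; have := ltn_ord s; lia.
rewrite se uk addr0; case: posnP => // k0; rewrite mxE /= inordK; last by lia.
rewrite prednK// leqnn; have -> : inord k = ord_max :> 'I_k.+1.
  by apply/val_inj; rewrite /= inordK.
by rewrite uk mulr0.
Qed.

(** S loses only the components of index 0; the others survive with the nonzero weight s. *)
Lemma pairing_vert_eq u u' eta : vert u = vert u' -> low_zero 1 eta ->
  pairing u eta = pairing u' eta.
Proof.
move=> uu' e1; apply: eq_bigr => s _; apply: eq_bigr => i _.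
have [s0|s0] := posnP (nat_of_ord s); first by rewrite !e1 ?s0// !mulr0.
have sk : (s.-1 < k)%N by have := ltn_ord s; lia.
have := congr1 (fun v : V => v (inord s.-1) i) uu'; rewrite !mxE inordK; last by lia.
rewrite sk prednK// inord_val => /mulfI -> //.
by rewrite pnatr_eq0; lia.
Qed.

(** [dT_form] changes the type of a form with each application. This version of d_T stays at order k
    and agrees with it on forms pulled back from orders below k. *)
Definition total w : V -> V := fun y => 'D_(canon 0 y) w y + raise (w y).

Definition vanish_from (U : set V) (n : nat) w :=
  forall y, U y -> forall (s : 'I_k.+1) i, (n <= s)%N -> w y s i = 0.

Variable U : set V.
Hypothesis oU : open U.

Lemma smooth_total w : smooth_on U w -> smooth_on U (total w).
Proof.
move=> sw; apply: smooth_onD => //; first exact: smooth_on_field_mx.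
exact: (smooth_on_linear_comp (@raise R m k) oU sw).
Qed.

Lemma smooth_iter_total n w : smooth_on U w -> smooth_on U (iter n total w).
Proof. by move=> sw; elim: n => //= n IH; exact: smooth_total. Qed.

Lemma smooth_vertS w : smooth_on U w -> smooth_on U (vertS w).
Proof. by move=> sw; exact: (smooth_on_linear_comp vert oU sw). Qed.

Lemma smooth_iter_vertS n w : smooth_on U w -> smooth_on U (iter n (@vertS _ _ _) w).
Proof. by move=> sw; elim: n => //= n IH; exact: smooth_vertS. Qed.

Lemma eq_total w w' y : (forall z, U z -> w z = w' z) -> U y -> total w y = total w' y.
Proof.
move=> ww' Uy; apply: (congr2 (fun a b => a + raise b)); last exact: ww'.
exact: eq_derive_open oU Uy ww'.
Qed.

Lemma total_linear (a : R) w w' y : smooth_on U w -> smooth_on U w' -> U y ->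
  total (fun z => a *: w z + w' z) y = a *: total w y + total w' y.
Proof.
move=> sw sw' Uy.
have dw := diff_derivable (v := canon 0 y) (smooth_on_diff sw Uy).
have dw' := diff_derivable (v := canon 0 y) (smooth_on_diff sw' Uy).
have dE : 'D_(canon 0 y) (fun z => a *: w z + w' z) y =
    a *: 'D_(canon 0 y) w y + 'D_(canon 0 y) w' y.
  have := deriveD (@derivableZ _ _ _ w a _ _ dw) dw'.
  by rewrite (@deriveZ _ _ _ w a _ _ dw).
by rewrite /total dE linearP scalerDr addrACA.
Qed.

Lemma iter_total0 p w y : (forall z, U z -> w z = 0) -> U y -> iter p total w y = 0.
Proof.
move=> w0; elim: p y => [|p IH] y Uy; first exact: w0.
rewrite iterS (@eq_total _ (fun=> 0) _ IH Uy) /total linear0 addr0.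
exact: (derive_cst (0 : V)).
Qed.

Lemma total_sum n (a : nat -> R) (F : nat -> V -> V) y :
  (forall p, smooth_on U (F p)) -> U y ->
  total (fun z => \sum_(p < n) a p *: F p z) y = \sum_(p < n) a p *: total (F p) y.
Proof.
move=> sF Uy; elim: n => [|n IH].
  rewrite big_ord0; apply: (@iter_total0 1) => // z _; exact: big_ord0.
rewrite big_ord_recr /= -IH.
rewrite (@eq_total _ (fun z => a n *: F n z + \sum_(p < n) a p *: F p z))//; last first.
  by move=> z _; rewrite big_ord_recr addrC.
rewrite total_linear//; first by rewrite addrC.
by apply: smooth_on_sum => // p _; exact: smooth_onZ.
Qed.

Lemma vanish_vertS n w : vanish_from U n.+1 w -> vanish_from U n (vertS w).
Proof.
move=> wn y Uy s i ns; rewrite mxE; case: ltnP => // sk.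
by rewrite wn ?mulr0// inordK.
Qed.

Lemma vanish_total n w : smooth_on U w -> vanish_from U n w ->
  vanish_from U n.+1 (total w).
Proof.
move=> sw wn y Uy s i ns; rewrite !mxE ifT ?wn ?addr0//; last 2 first.
- by rewrite inordK; have := ltn_ord s; lia.
- by lia.
rewrite derive_mx; last by apply: diff_derivable; exact: smooth_on_diff sw Uy.
rewrite mxE (@eq_derive_open _ _ _ U _ (cst 0)) ?derive_cst// => z Uz.
by rewrite wn//; lia.
Qed.

Lemma vanish_iter_total n p w : smooth_on U w -> vanish_from U n w ->
  vanish_from U (p + n) (iter p total w).
Proof.
move=> sw wn; elim: p => //= p IH; apply: vanish_total => //.
exact: smooth_iter_total.
Qed.

Lemma vert_total w y : smooth_on U w -> vanish_from U k w -> U y ->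
  vertS (total w) y = total (vertS w) y + w y.
Proof.
move=> sw wk Uy; rewrite -[LHS]/(vert (total w y)) /total linearD /= vert_raise; last first.
  by move=> i; exact: wk.
rewrite -[vertS w]/(fun z => vert (w z)) derive_linear_comp ?addrA//.
exact: smooth_on_diff sw Uy.
Qed.

(** Each of the p + 1 commutations of S with d_T contributes one d_T^p. Vanishing from k - p leaves
    room for p shifts before the top row is occupied. *)
Lemma vert_iter_total p w y : smooth_on U w -> vanish_from U (k - p) w ->
  (p <= k)%N -> U y ->
  vertS (iter p.+1 total w) y =
  iter p.+1 total (vertS w) y + p.+1%:R *: iter p total w y.
Proof.
elim: p y => [|p IH] y sw wk pk Uy.
  by rewrite /= scale1r vert_total//; rewrite subn0 in wk.
rewrite [iter p.+2 _ w]iterS vert_total//; [|exact: smooth_iter_total|]; last first.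
  by have := @vanish_iter_total _ p.+1 w sw wk; rewrite subnKC.
rewrite (@eq_total _
  (fun z => p.+1%:R *: iter p total w z + iter p.+1 total (vertS w) z))//; last first.
  move=> z Uz; rewrite IH ?(ltnW pk)//; first by rewrite addrC.
  move=> x Ux s i ks; apply: wk => //; lia.
rewrite total_linear//; [|exact: smooth_iter_total|]; last first.
  by apply: smooth_iter_total; exact: smooth_vertS.
by rewrite addrC addrA -!iterS -[p.+2%:R]natr1 scalerDl scale1r [X in X + _]addrC addrC.
Qed.

Variables (n : nat) (L : V -> R).
Hypotheses (nk : (n <= k)%N) (smL : smooth_on U L).
Hypothesis L_low : forall y zeta, U y -> low_zero n.+1 zeta -> 'D_zeta L y = 0.

Definition momentum p := iter p total (iter p.+1 (@vertS _ _ _) (dfun L)).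

Lemma smooth_dfun : smooth_on U (dfun L).
Proof.
apply: smooth_on_mx => // i j.
apply: (@eq_smooth_on _ _ _ U ('D_(delta_mx i j) L)) (smooth_on_derive _ smL) => //.
by move=> z _; rewrite mxE.
Qed.

Lemma smooth_momentum p : smooth_on U (momentum p).
Proof. by apply: smooth_iter_total; apply: smooth_iter_vertS; exact: smooth_dfun. Qed.

Lemma vanish_dfun : vanish_from U n.+1 (dfun L).
Proof.
move=> y Uy s i ns; rewrite mxE L_low// => u j un; rewrite mxE.
by case: eqP un => [->|//]; rewrite ltnNge ns.
Qed.

Lemma vanish_iter_vertS p : (p <= n.+1)%N ->
  vanish_from U (n.+1 - p) (iter p (@vertS _ _ _) (dfun L)).
Proof.
elim: p => [|p IH] pn; first exact: vanish_dfun.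
by rewrite iterS; apply: vanish_vertS; rewrite -subSn//; apply: IH; exact: ltnW.
Qed.

(** dL vanishes from index n + 1 on; S^(p+1) lowers this bound by p + 1 and d_T^p raises it by p. *)
Lemma vanish_momentum p : (p <= n)%N -> vanish_from U n (momentum p).
Proof.
move=> pn.
have := @vanish_iter_total _ p _ (@smooth_iter_vertS p.+1 _ smooth_dfun)
  (@vanish_iter_vertS p.+1 pn).
by rewrite subSS subnKC.
Qed.

Definition hilbert_sum (y : V) : V :=
  \sum_(p < n) ((-1) ^+ p / (p.+1)`!%:R) *: momentum p y.

Lemma smooth_hilbert_sum : smooth_on U hilbert_sum.
Proof.
apply: smooth_on_sum => // p _; apply: smooth_onZ => //; exact: smooth_momentum.
Qed.

Lemma vanish_hilbert_sum : vanish_from U n hilbert_sum.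
Proof.
move=> y Uy s i ns; rewrite summxE big1// => p _.
by rewrite mxE (vanish_momentum _ Uy)// ?mulr0// ltnW.
Qed.

(* By the commutation rule [S d_T = d_T S + 1] the sum telescopes. *)
Lemma vert_total_hilbert_sum y : U y ->
  vert (total hilbert_sum y) = vert (dfun L y).
Proof.
move=> Uy.
rewrite (@total_sum n (fun p => (-1) ^+ p / (p.+1)`!%:R) momentum y smooth_momentum Uy).
rewrite raddf_sum /=.
(* The coefficient (-1)^p / (p+1)! is a_p / (p+1) and also -a_(p+1), which fits the two terms of S
   d_T^(p+1) S^(p+1) dL = (p+1) d_T^p S^(p+1) dL + d_T^(p+1) S^(p+2) dL. *)
pose a p : R := (-1) ^+ p / p`!%:R.
have step (p : 'I_n) : vert (((-1) ^+ p / (p.+1)`!%:R) *: total (momentum p) y) =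
    a p *: momentum p y - a p.+1 *: momentum p.+1 y.
  rewrite linearZ /=.
  rewrite -[vert _]/(vertS (iter p.+1 total (iter p.+1 (@vertS _ _ _) (dfun L))) y).
  rewrite vert_iter_total//; last 3 first.
  - by apply: smooth_iter_vertS; exact: smooth_dfun.
  - move=> z Uz s i ks; apply: (@vanish_iter_vertS p.+1) => //; [|by lia].
    by have := ltn_ord p; lia.
  - by have := ltn_ord p; lia.
  rewrite scalerDr addrC scalerA; congr (_ *: _ + _).
    rewrite /a factS natrM.
    have p0 : p.+1%:R != 0 :> R by rewrite pnatr_eq0.
    have f0 : p`!%:R != 0 :> R by rewrite pnatr_eq0 -lt0n fact_gt0.
    move: (p.+1%:R : R) (p`!%:R : R) ((-1 : R) ^+ p) p0 f0 => x z e x0 z0.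
    by field; rewrite z0 x0.
  rewrite -[RHS]scaleNr; congr (_ *: _).
  by rewrite /a exprS mulN1r mulNr opprK.
rewrite (eq_bigr _ (fun p _ => step p)).
rewrite -(big_mkord xpredT (fun p => a p *: momentum p y - a p.+1 *: momentum p.+1 y)).
rewrite (@telescope_sumr_eq _ 0 n (fun p => - (a p *: momentum p y))) //; last first.
  by move=> p _; rewrite opprK addrC.
have a0 : a 0%N = 1 by rewrite /a expr0 fact0 divr1.
rewrite opprK a0 scale1r.
(* S^(n+1) dL = 0, since dL has components of index at most n. *)
have -> : momentum n y = 0.
  apply: iter_total0 => // z Uz; apply/matrixP => s i; rewrite [RHS]mxE.
  by have := @vanish_iter_vertS n.+1 (leqnn _) z Uz s i; rewrite subnn; apply.
by rewrite scaler0 oppr0 add0r.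
Qed.

Lemma hilbert_sum_first_variation y eta : U y -> low_zero 1 eta ->
  pairing (hilbert_sum y) (canon 0 eta) =
  'D_eta L y - 'D_(canon 0 y) (fun z => pairing (hilbert_sum z) eta) y.
Proof.
move=> Uy e1; have dh := smooth_on_diff smooth_hilbert_sum Uy.
have tE : pairing (total hilbert_sum y) eta =
    'D_(canon 0 y) (fun z => pairing (hilbert_sum z) eta) y
    + pairing (hilbert_sum y) (canon 0 eta).
  rewrite -pairing_raise pairingC /total linearD /= ![pairing eta _]pairingC.
  congr (_ + _); rewrite -[LHS]pairingC -(derive_linear_comp _ _ dh).
  by have -> : (fun z => pairing (hilbert_sum z) eta) = pairing eta \o hilbert_sum
    by apply/funext => z; rewrite pairingC.
have -> : 'D_eta L y = pairing (dfun L y) eta.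
  rewrite (derive_coord_sum _ (smooth_on_diff smL Uy)) /pairing.
  by apply: eq_bigr => i _; apply: eq_bigr => j _; rewrite mxE mulrC.
rewrite -(pairing_vert_eq (vert_total_hilbert_sum Uy) e1) tE.
by rewrite addrAC subrr add0r.
Qed.

End TotalDerivative.

(** * Pull-backs to the jets of order 2n-1 *)

Section PullbackCalculus.
Context {R : realType}.

(** Both sides are limits of literally the same difference quotient. *)
Lemma derive_comp_linear (V V' W : normedModType R) (A : {linear V -> V'})
    (f : V' -> W) (y v : V) : 'D_v (fun z => f (A z)) y = 'D_(A v) f (A y).
Proof.
rewrite /derive.
have -> // : (fun h => h^-1 *: (((fun z => f (A z)) \o shift y) (h *: v) - f (A y)))
  = (fun h => h^-1 *: ((f \o shift (A y)) (h *: A v) - f (A y))).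
have AE h : A (h *: v + y) = h *: A v + A y by exact: linearP.
by apply/funext => h; rewrite /= AE.
Qed.

Lemma smooth_on_comp_linear p q (V' W : normedModType R) (U : set 'M[R]_(p, q))
    (U' : set V') (A : {linear 'M[R]_(p, q) -> V'}) (f : V' -> W) :
  smooth_on U' f -> (forall y, U y -> U' (A y)) -> smooth_on U (fun z => f (A z)).
Proof.
move=> sf UU' vs y Uy.
have -> : foldr (fun v g => 'D_v g) (fun z => f (A z)) vs
    = (foldr (fun v g => 'D_v g) f (map A vs)) \o A.
  elim: vs => //= v vs ->; apply/funext => z.
  exact: (derive_comp_linear A).
apply: differentiable_comp; first exact: mx_linear_differentiable.
by apply: sf; exact: UU'.
Qed.

End PullbackCalculus.

Section Truncation.
Context {R : realType} {m : nat}.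
Local Notation coords k := ('M[R]_(k.+1, m)).

Lemma trunc_is_linear k j : linear (@trunc R m k j).
Proof. by move=> a u v; apply/matrixP => s i; rewrite !mxE. Qed.

HB.instance Definition _ k j :=
  GRing.isLinear.Build R (coords k) (coords j) *:%R (@trunc R m k j)
    (@trunc_is_linear k j).

Definition pad (j k : nat) (v : coords j) : coords k :=
  \matrix_(s, i) if (s <= j)%N then v (inord s) i else 0.

Lemma pad_is_linear j k : linear (@pad j k).
Proof.
move=> a u v; apply/matrixP => s i; rewrite !mxE.
by case: leqP => _; rewrite ?mulr0 ?addr0.
Qed.

HB.instance Definition _ j k :=
  GRing.isLinear.Build R (coords j) (coords k) *:%R (@pad j k)
    (@pad_is_linear j k).

Lemma padK j k : (j <= k)%N -> cancel (@pad j k) (@trunc R m k j).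
Proof.
move=> jk v; apply/matrixP => s i; rewrite !mxE inordK; last by have := ltn_ord s; lia.
by rewrite -ltnS ltn_ord inord_val.
Qed.

Lemma trunc_trunc i j k (y : coords k) : (i <= j)%N -> (j <= k)%N ->
  trunc i (trunc j y) = trunc i y.
Proof.
move=> ij jk; apply/matrixP => s a; rewrite !mxE; congr (y _ _).
by apply: val_inj; rewrite /= !inordK//; have := ltn_ord s; lia.
Qed.

Lemma trunc_delta j k (s : 'I_k.+1) (i : 'I_m) : (j <= k)%N ->
  trunc j (delta_mx s i : coords k) = if (s <= j)%N then delta_mx (inord s) i else 0.
Proof.
move=> jk; apply/matrixP => t a; rewrite !mxE.
have -> : (inord t == s) = (nat_of_ord t == s).
  by rewrite -val_eqE /= inordK//; have := ltn_ord t; lia.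
case: leqP => sj; rewrite mxE.
  by have -> : (t == inord s) = (nat_of_ord t == s) by rewrite -val_eqE /= inordK.
by case: eqP => // ts; have := ltn_ord t; lia.
Qed.

(** For r >= 1 row s of the field reads order s + 1 - r <= s, so the field projects to lower jets;
    [canon 0] reads one order higher. *)
Lemma trunc_canon r j k (y : coords k) : (0 < r)%N -> (j <= k)%N ->
  trunc j (canon r y) = canon r (trunc j y).
Proof.
move=> r0 jk; apply/matrixP => s i; have sj := ltn_ord s.
rewrite !mxE inordK; last by lia.
rewrite /entry !ifT; try lia.
rewrite mxE; congr (_ * y _ _); apply: val_inj.
by rewrite /= !inordK//; lia.
Qed.

Lemma pullback_dfun n k (L : coords n -> R) : (n <= k)%N ->
  pullback (dfun L) = dfun (fun y : coords k => L (trunc n y)).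
Proof.
move=> nk; apply/funext => y; apply/matrixP => s i; rewrite !mxE.
rewrite (derive_comp_linear (@trunc R m k n)) /= trunc_delta//.
by case: leqP => _; rewrite ?derive0.
Qed.

Lemma pullback_vertS n k (w : coords n -> coords n) : (n <= k)%N ->
  pullback (vertS w) = vertS (pullback w) :> (coords k -> coords k).
Proof.
move=> nk; apply/funext => y; apply/matrixP => s i; rewrite !mxE.
have [sn|ns] := ltnP s n.
  have sk : (s < k)%N by exact: leq_trans sn nk.
  by rewrite sk (ltnW sn) !inordK ?sn//; lia.
have -> : (if (s < k)%N then s.+1%:R * (if (@inord k s.+1 <= n)%N then
    w (trunc n y) (inord (@inord k s.+1)) i else 0) else 0) = 0.
  by have [sk|//] := ltnP s k; rewrite inordK// ltnNge ns mulr0.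
by have [sn|//] := leqP s n; rewrite inordK// ltnNge ns.
Qed.

Lemma pullback_iter_vertS p n k (w : coords n -> coords n) : (n <= k)%N ->
  pullback (iter p (@vertS _ _ _) w) = iter p (@vertS _ _ _) (pullback w)
  :> (coords k -> coords k).
Proof. by move=> nk; elim: p => //= p IH; rewrite pullback_vertS// IH. Qed.

Variables (k : nat) (U : set (coords k)).
Hypothesis oU : open U.

(* Differentiability of [f] at [trunc j y] is recovered from that of its
   pull-back through the section [pad]. *)
Lemma dT_fun_trunc j (f : coords j -> R) (y : coords k) : (j < k)%N ->
  differentiable (fun z => f (trunc j z)) y ->
  dT_fun f (trunc j.+1 y) = 'D_(canon 0 y) (fun z => f (trunc j z)) y.
Proof.
move=> jk df; have jk' := ltnW jk.
have dE v : 'D_v f (trunc j y) = 'd (fun z => f (trunc j z)) y (pad k v).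
  rewrite -deriveE// (derive_comp_linear (@trunc R m k j)) /=.
  by rewrite padK.
rewrite (derive_comp_linear (@trunc R m k j)) /= dE.
rewrite (matrix_sum_delta (trunc j (canon 0 y))) !raddf_sum /dT_fun.
apply: eq_bigr => r _; rewrite !raddf_sum; apply: eq_bigr => i _.
have linZ (c : R) (v : coords j) : 'd (fun z => f (trunc j z)) y (pad k (c *: v))
    = c * 'd (fun z => f (trunc j z)) y (pad k v).
  have -> : pad k (c *: v) = c *: pad k v by exact: linearZZ.
  exact: linearZZ.
transitivity (trunc j (canon 0 y) r i
  * 'd (fun z => f (trunc j z)) y (pad k (delta_mx r i))); last exact/esym/linZ.
rewrite trunc_trunc// dE; congr (_ * _).
have rj := ltn_ord r.
rewrite [RHS]mxE canon0E /entry inordK; last by lia.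
rewrite ifT; last by lia.
by rewrite mxE; congr (y _ _); apply: val_inj; rewrite /= !inordK//; lia.
Qed.

(** As j < k, the coordinates of order up to j + 1 that d_T reads are all present, and the cut in
    row k of [canon 0] is not seen by a form of order j. *)
Lemma pullback_dT_form j (w : coords j -> coords j) (y : coords k) : (j < k)%N ->
  smooth_on U (pullback w : coords k -> coords k) -> U y ->
  pullback (dT_form w) y = total (pullback w) y.
Proof.
move=> jk sw Uy; apply/matrixP => s i; have jk' := ltnW jk.
rewrite [RHS]mxE derive_mx; last by apply: diff_derivable; exact: smooth_on_diff sw Uy.
have dw : differentiable (fun z => pullback w z s i : R) y.
  exact: smooth_on_diff (smooth_on_coord s i oU sw) Uy.
rewrite [LHS]mxE [dT_form _ _ _ _]mxE [X in _ = X + _]mxE [raise _ _ _]mxE.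
have sk := ltn_ord s.
have [sj|sj] := leqP s j.+1; last first.
  rewrite ifT; last by lia.
  rewrite [pullback _ _ _ _]mxE ifF; last by rewrite inordK; lia.
  rewrite addr0; under eq_fun do rewrite mxE leqNgt (ltnW sj) /=.
  by rewrite -[RHS]/('D_(canon 0 y) (cst (0 : R)) y) derive_cst.
rewrite inordK//.
congr (_ + _); last first.
  case: posnP => // s0; rewrite mxE inordK; last by lia.
  rewrite ifT; last by lia.
  rewrite trunc_trunc//; congr (w _ _ _).
have wE : (fun z => pullback w z s i) =
   (fun z => if (s <= j)%N then w (trunc j z) (inord s) i else 0).
  by apply/funext => z; rewrite mxE.
rewrite wE; rewrite wE in dw.
move: dw; have [sj'|sj'] := leqP s j; move=> dw; last first.
  by rewrite -[RHS]/('D_(canon 0 y) (cst (0 : R)) y) derive_cst.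
by rewrite (dT_fun_trunc jk dw).
Qed.

Lemma pullback_dT_iter p n (w : coords n -> coords n) (y : coords k) : (p + n <= k)%N ->
  smooth_on U (pullback w : coords k -> coords k) -> U y ->
  pullback (@dT_iter R m p n w) y = iter p (@total R m k) (pullback w) y.
Proof.
elim: p y => [|p IH] y pnk sw Uy //.
rewrite /= pullback_dT_form//.
  by apply: (eq_total oU) => // z Uz; apply: IH => //; exact: ltnW.
apply: eq_smooth_on (smooth_iter_total oU p sw) => // z Uz.
by rewrite IH//; exact: ltnW.
Qed.

End Truncation.

Section HilbertFormPullback.
Context {R : realType} {m n : nat}.
Local Notation k := (n.*2.-1).
Local Notation coords k := ('M[R]_(k.+1, m)).
Variables (U : set (coords k)) (U' : set (coords n)) (L : coords n -> R).
Hypotheses (oU : open U) (n0 : (0 < n)%N) (smL : smooth_on U' L).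
Hypothesis UU' : forall y, U y -> U' (trunc n y).

Let nk : (n <= k)%N. Proof. by rewrite -addnn; lia. Qed.

Lemma smooth_pullback : smooth_on U (fun y => L (trunc n y)).
Proof. exact: (smooth_on_comp_linear (A := @trunc R m k n)) smL UU'. Qed.

Lemma hilbert_formE y : U y ->
  hilbert_form L y = hilbert_sum n (fun z => L (trunc n z)) y.
Proof.
move=> Uy; apply: eq_bigr => p _; congr (_ *: _).
have pn := ltn_ord p.
(* d_T^p S^(p+1) dL has order p + n <= 2n-1 because p < n. *)
rewrite (@pullback_dT_iter _ _ _ U)//; last 2 first.
- by rewrite -addnn; lia.
- rewrite pullback_iter_vertS// pullback_dfun//.
  apply: smooth_iter_vertS => //; apply: smooth_dfun => //; exact: smooth_pullback.
by rewrite pullback_iter_vertS// pullback_dfun.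
Qed.

Lemma derive_pullback_low y zeta : low_zero n.+1 zeta ->
  'D_zeta (fun z : coords k => L (trunc n z)) y = 0.
Proof.
move=> zn; rewrite (derive_comp_linear (@trunc R m k n)) /=.
have -> : trunc n zeta = 0; last by rewrite derive0.
apply/matrixP => s i; rewrite !mxE zn// inordK ?ltn_ord//.
by rewrite (leq_trans (ltn_ord s)).
Qed.

Lemma eq_ker_d (w w' : coords k -> coords k) y : U y -> (forall z, U z -> w z = w' z) ->
  ker_d w y = ker_d w' y.
Proof.
move=> Uy ww'; apply/seteqP; split=> xi H eta; rewrite -(H eta) /ext_d;
  congr (_ - _); apply: (eq_derive_open _ oU Uy) => z Uz; by rewrite ww'.
Qed.

Hypothesis zermeloL : forall y, U' y -> 'D_(Delta 1 y) L y = L y /\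
  forall r, (2 <= r <= n)%N -> 'D_(Delta r y) L y = 0.

Lemma Delta_ker_hilbert_form r y : (0 < r)%N -> U y ->
  ker_d (hilbert_form L) y (Delta r y).
Proof.
move=> r0 Uy; rewrite (eq_ker_d Uy hilbert_formE) -canon_Delta//.
case: r r0 => // r _.
have sm := smooth_pullback.
have low z zeta : U z -> low_zero n.+1 zeta ->
    'D_zeta (fun z : coords k => L (trunc n z)) z = 0.
  by move=> _; exact: derive_pullback_low.
apply: (@canon_ker R m k n U (fun y => L (trunc n y))) => //.
- by rewrite -addnn; lia.
- move=> eta; have := smooth_hilbert_sum oU n sm.
  move=> /(smooth_on_linear_comp (pairing eta) oU).
  by apply: eq_smooth_on => // z _; rewrite pairingC.
- exact: vanish_hilbert_sum.
- move=> z eta Uz; exact: (hilbert_sum_first_variation oU).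
- move=> z s Uz; rewrite (derive_comp_linear (@trunc R m k n)) /=.
  rewrite trunc_canon// canon_Delta//.
  have [ZL1 ZL] := zermeloL (UU' Uz).
  case: s => [|s]; first by rewrite ZL1 mul1r.
  (* Above order n the condition is automatic: Delta^r with r > n projects to 0 on the jets of order
     n. *)
  rewrite mul0r; have [sn|ns] := leqP s.+2 n; first by rewrite ZL// sn.
  rewrite -canon_Delta//; have -> : canon s.+2 (trunc n z) = 0; last by rewrite derive0.
  apply/matrixP => t i; rewrite [RHS]mxE canon_low//.
  exact: leq_trans (ltn_ord t) _.
Qed.

End HilbertFormPullback.

(** * Coordinates of slit jets *)

Section SmoothPolynomial.
Context {R : realType}.

Lemma smooth_on_id (U : set R) : open U -> smooth_on U (@id R).
Proof.
move=> oU; apply/smooth_onP => -[|n]; split=> //.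
move=> v; have /smooth_onP/(_ n) := smooth_on_cst v oU.
by apply: eq_diffn => // x _; rewrite derive_id.
Qed.

Lemma smooth_on_expr (U : set R) r : open U -> smooth_on U (fun t : R => t ^+ r).
Proof.
move=> oU; elim: r => [|r IH].
  by apply: (eq_smooth_on oU _ (smooth_on_cst (1 : R) oU)) => t _; rewrite expr0.
apply: (eq_smooth_on oU _ (smooth_onM oU (smooth_on_id oU) IH)) => t _.
by rewrite exprS.
Qed.

End SmoothPolynomial.

Section SlitJets.
Context {R : realType} {m : nat} (M : manifold R m) (k : nat).
Hypothesis k0 : (0 < k)%N.
Implicit Types (c : chart R m M) (y : 'M[R]_(k.+1, m)).

Let taylor y : R -> 'rV[R]_m := fun t => \sum_(r < k.+1) (t ^+ r / r`!%:R) *: row r y.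

Let smooth_taylor y (J : set R) : open J -> smooth_on J (taylor y).
Proof.
move=> oJ; apply: smooth_on_sum => // r _; apply: smooth_onZl => //.
apply: smooth_onM => //; first exact: smooth_on_expr.
exact: smooth_on_cst.
Qed.

Let taylor0 y : taylor y 0 = row 0 y.
Proof.
rewrite /taylor big_ord_recl expr0 fact0 divr1 scale1r big1 ?addr0// => i _.
by rewrite exprS !mul0r scale0r.
Qed.

Let derive_taylor0 y : 'D_1 (taylor y) 0 = row (inord 1) y.
Proof.
pose kr (r : 'I_k.+1) : R -> R := r`!%:R^-1 \o* (@GRing.exp R ^~ r).
have dkr r : differentiable (kr r) (0 : R).
  by apply/derivable1_diffP; apply: derivableM => //; exact: exprn_derivable.
have kr0 r : 'D_1 (kr r) 0 = (r == inord 1 :> 'I_k.+1)%:R.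
  rewrite /kr deriveMr; last exact: exprn_derivable.
  rewrite exp_derive /= -val_eqE /= inordK//; case: (nat_of_ord r) => [|[|r']] /=.
  - by rewrite !scale0r mulr0.
  - by rewrite expr0 !scale1r factS fact0 invr1 mulr1.
  - by rewrite exprS mul0r scaler0 scale0r mulr0.
have -> : taylor y = \sum_(r < k.+1) (fun t => kr r t *: row r y).
  by apply/funext => t; rewrite fct_sumE.
rewrite derive_sum => [|r]; last first.
  by apply: diff_derivable; exact: differentiableZl.
rewrite (bigD1 (inord 1))//= big1 ?addr0 => [|r /negbTE r1].
  rewrite deriveE; last exact: differentiableZl.
  by rewrite diffZl// -deriveE// kr0 eqxx scale1r.
rewrite deriveE; last exact: differentiableZl.
by rewrite diffZl// -deriveE// kr0 r1 scale0r.
Qed.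

Let taylor_nbhs c y : chart_im c (row 0 y) ->
  exists J : set R, [/\ open J, J 0 & forall t, J t -> chart_im c (taylor y t)].
Proof.
move=> y0; exists (taylor y @^-1` chart_im c); split=> //; last by rewrite /= taylor0.
apply: open_comp; last exact: chart_im_open.
move=> t _; apply: differentiable_continuous.
exact: smooth_on_diff (smooth_taylor y openT) _.
Qed.

Let chart_taylor c y t : chart_im c (taylor y t) ->
  chart_map c (taylor_curve c y t) = taylor y t.
Proof. by move=> yt; rewrite /taylor_curve chart_invK. Qed.

Let taylor_curve0 c y : taylor_curve c y 0 = chart_inv c (row 0 y).
Proof. by rewrite /taylor_curve -taylor0. Qed.

Let derive_chart_taylor c y : chart_im c (row 0 y) ->
  (chart_map c \o taylor_curve c y)^`()%classic 0 = row (inord 1) y.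
Proof.
move=> y0; have [J [oJ J0 JP]] := taylor_nbhs y0.
rewrite derive1E -derive_taylor0.
by apply: (eq_derive_open _ oJ J0) => t /JP; exact: chart_taylor.
Qed.

Let smooth_curve_taylor c y : atlas c -> chart_im c (row 0 y) ->
  smooth_curve (taylor_curve c y).
Proof.
move=> ac y0; have [J [oJ J0 JP]] := taylor_nbhs y0.
have /nbhs_ballP[e /= e0 eJ] := open_nbhs_nbhs (conj oJ J0).
exists (- e), e; split=> [||t /andP[te et]]; rewrite ?oppr_lt0//.
exists c, J; split=> //.
- by apply: eJ; rewrite /ball /= sub0r normrN ltr_norml te et.
- by move=> s /JP sJ; rewrite /= /taylor_curve; exact: chart_inv_dom.
- by apply: (eq_smooth_on oJ _ (smooth_taylor y oJ)) => s /JP /chart_taylor /= ->.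
Qed.

(** Chain rule through the transition map: differentiability and zero velocity at 0 pass from one
    chart to another. *)
Let curve_chart_change c c' (g : R -> M) : atlas c -> atlas c' ->
  chart_dom c (g 0) -> chart_dom c' (g 0) ->
  differentiable (chart_map c \o g) (0 : R) ->
  (\forall t \near (0 : R), chart_dom c (g t)) ->
  differentiable (chart_map c' \o g) (0 : R) /\
  ('D_1 (chart_map c \o g) 0 = 0 -> 'D_1 (chart_map c' \o g) 0 = 0).
Proof.
move=> ac ac' gc gc' dg cg.
have dT : differentiable (chart_map c' \o chart_inv c) (chart_map c (g 0)).
  apply: (smooth_on_diff (atlas_smooth ac ac')); split; first exact: chart_map_im.
  by rewrite chart_mapK.
have gE : \forall t \near (0 : R),
    ((chart_map c' \o chart_inv c) \o (chart_map c \o g)) t = (chart_map c' \o g) t.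
  by apply: filterS cg => t gt /=; rewrite chart_mapK.
have dTg := differentiable_comp dg dT.
split.
  exact: eq_differentiable_open (@open_interior _ _) gE (@interior_subset _ _) dTg.
rewrite (deriveE _ dg) => g0.
have <- := @near_eq_derive _ _ _ _ _ (0 : R) 1 gE.
by rewrite (deriveE _ dTg) (diff_comp dg dT) /= g0 linear0.
Qed.

Lemma jlocal_slit c y : atlas c ->
  jlocal k (slit_jets M k) c y <-> chart_im c (row 0 y) /\ row (inord 1) y != 0.
Proof.
move=> ac; split=> [[y0 [g [sg jE [c' [ac' gc' g'0]]]]]|[y0 y1]]; last first.
  split=> //; exists (taylor_curve c y); split=> //; first exact: smooth_curve_taylor.
  exists c; split=> //; first by rewrite taylor_curve0; exact: chart_inv_dom.
  by rewrite derive_chart_taylor.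
split=> //; apply: contra_neqN g'0 => /eqP y1.
have [_ gt gj] : jet k (taylor_curve c y) g by rewrite jE.
have gc : chart_dom c (g 0) by rewrite gt taylor_curve0; exact: chart_inv_dom.
have gc0 : 'D_1 (chart_map c \o g) 0 = 0.
  rewrite -derive1E -y1 -(derive_chart_taylor y0); apply/rowP => i.
  have := congr1 (fun v : 'M[R]_(k.+1, m) => v (inord 1) i) (gj c ac _).
  by rewrite -gt => /(_ gc); rewrite !mxE inordK.
(* The representative g is known to be smooth only in some chart c2, and its velocity is tested in
   yet another chart c'. Differentiability goes from c2 to c, then zero velocity from c to c'. *)
have [a [b [a0 b0 /(_ 0)]]] := sg; rewrite a0 b0.
move=> /(_ isT) [c2 [J [ac2 oJ J0 Jg sJ]]].
have g2 := smooth_on_diff sJ J0; have gc2 : chart_dom c2 (g 0) by exact: Jg.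
have gc2n : \forall t \near (0 : R), chart_dom c2 (g t).
  by apply: filterS (open_nbhs_nbhs (conj oJ J0)) => t /Jg.
have gcn : \forall t \near (0 : R), chart_dom c (g t).
  have co : {for 0, continuous (chart_inv c2 \o (chart_map c2 \o g))}.
    apply: continuous_comp; first exact: differentiable_continuous.
    by apply: chart_inv_cont; exact: chart_map_im.
  have : nbhs (chart_inv c2 (chart_map c2 (g 0))) (chart_dom c).
    by rewrite chart_mapK//; apply: open_nbhs_nbhs; split=> //; exact: chart_dom_open.
  move=> /co cn; apply: filterS (filterI gc2n cn) => t [t2 /=].
  by rewrite chart_mapK.
have [dg _] := curve_chart_change ac2 ac gc2 gc g2 gc2n.
by rewrite derive1E; have [_ ->] := curve_chart_change ac ac' gc gc' dg gcn.
Qed.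

Lemma open_jlocal_slit c : atlas c -> open (jlocal k (slit_jets M k) c).
Proof.
move=> ac; have -> : jlocal k (slit_jets M k) c =
    (row 0 @^-1` chart_im c) `&` (row (inord 1) @^-1` [set~ 0]).
  apply/seteqP; split=> y.
    by move=> /(jlocal_slit _ ac)[? /eqP].
  by move=> [? /eqP y1]; apply/(jlocal_slit _ ac).
apply: openI; apply: open_comp.
- move=> y _; apply: differentiable_continuous.
  exact: (mx_linear_differentiable (row 0)).
- exact: chart_im_open.
- move=> y _; apply: differentiable_continuous.
  exact: (mx_linear_differentiable (row (inord 1))).
- apply: closed_openC; apply: accessible_closed_set1.
  by apply: hausdorff_accessible; exact: norm_hausdorff.
Qed.

End SlitJets.

Lemma jlocal_slit_trunc (R : realType) (m : nat) (M : manifold R m) (j k : nat)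
    (c : chart R m M) (y : 'M[R]_(k.+1, m)) : (0 < j <= k)%N -> atlas c ->
  jlocal k (slit_jets M k) c y -> jlocal j (slit_jets M j) c (trunc j y).
Proof.
move=> /andP[j0 jk] ac; have k0 := leq_trans j0 jk.
move=> /(jlocal_slit k0 _ ac)[y0 y1]; apply/(jlocal_slit j0 _ ac).
have -> : row 0 (trunc j y) = row 0 y.
  by apply/rowP => i; rewrite !mxE; congr (y _ _); apply/val_inj; rewrite /= inordK.
have -> // : row (inord 1) (trunc j y) = row (inord 1) y.
by apply/rowP => i; rewrite !mxE; congr (y _ _); apply/val_inj; rewrite /= !inordK.
Qed.

(** * The kernel of the differential of the Hilbert form *)

Section KernelInvolutive.
Context {R : realType} {m k : nat}.
Local Notation V := 'M[R]_(k.+1, m).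
Variables (U : set V) (w X Y : V -> V).
Hypotheses (oU : open U) (smw : smooth_on U w).

Let smooth_pairing eta : smooth_on U (fun z => pairing (w z) eta).
Proof.
apply: (eq_smooth_on oU _ (smooth_on_linear_comp (pairing eta) oU smw)) => z _.
by rewrite /= pairingC.
Qed.

Let derive_pairing_const eta v y : U y ->
  'D_v (fun z => pairing (w z) eta) y = pairing ('D_v w y) eta.
Proof.
move=> Uy; have dw := smooth_on_diff smw Uy.
have -> : (fun z => pairing (w z) eta) = (fun z => pairing eta (w z)).
  by apply/funext => z; rewrite pairingC.
by rewrite (derive_linear_comp (pairing eta) v dw) /= pairingC.
Qed.

Lemma ext_dC y xi eta : ext_d w y xi eta = - ext_d w y eta xi.
Proof. by rewrite /ext_d opprB. Qed.

Let addr_sub_eq0 (a b c d : R) : a + b = c + d -> a - c + (b - d) = 0.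
Proof. lra. Qed.

Let sub_eq0_cancel (p q q' e e' : R) :
  p - q + e = 0 -> p - q' + e' = 0 -> q - q' = 0 -> e - e' = 0.
Proof. lra. Qed.

Lemma ext_dB y xi xi' eta : U y ->
  ext_d w y (xi - xi') eta = ext_d w y xi eta - ext_d w y xi' eta.
Proof.
move=> Uy; rewrite /ext_d.
rewrite (derive_pairing_const eta (xi - xi') Uy) (derive_pairing_const eta xi Uy).
rewrite (derive_pairing_const eta xi' Uy) (derive_pairing_const (xi - xi') eta Uy).
rewrite (derive_pairing_const xi eta Uy) (derive_pairing_const xi' eta Uy).
have -> : pairing ('D_eta w y) (xi - xi')
    = pairing ('D_eta w y) xi - pairing ('D_eta w y) xi' by exact: linearB.
have -> : 'D_(xi - xi') w y = 'D_xi w y - 'D_xi' w y.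
  have dw := smooth_on_diff smw Uy.
  by rewrite (deriveE _ dw) linearB /= -!(deriveE _ dw).
rewrite !(pairingC (_ - _)) linearB /= !(pairingC eta).
by rewrite opprD addrACA opprD.
Qed.

(** The identity dw(Z, eta) = 0 differentiated along v, with Z varying and eta constant. *)
Let derive_ext_d (Z : V -> V) y v eta : U y -> differentiable Z y ->
  (forall z, U z -> ker_d w z (Z z)) ->
  'D_(Z y) ('D_v (fun z => pairing (w z) eta)) y
  - 'D_v ('D_eta (fun z => pairing (w z) (Z y))) y
  + ext_d w y ('D_v Z y) eta = 0.
Proof.
move=> Uy dZ kZ.
have sDw := smooth_on_derive eta smw.
have dDw i j : differentiable (fun z => 'D_eta w z i j) y.
  exact: smooth_on_diff (smooth_on_coord i j oU sDw) Uy.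
have H1 := derive_field v oU Uy (smooth_pairing eta) dZ.
have H2 := derive_pairing v dDw dZ.
have H3 : 'D_v (fun z => 'D_(Z z) (fun x => pairing (w x) eta) z) y
    = 'D_v (fun z => pairing ('D_eta w z) (Z z)) y.
  apply: (eq_derive_open _ oU Uy) => z Uz.
  have := kZ z Uz eta; rewrite /ext_d => /eqP; rewrite subr_eq0 => /eqP ->.
  by rewrite derive_pairing_const.
have H4 : 'D_v (fun z => pairing ('D_eta w z) (Z y)) y
    = 'D_v ('D_eta (fun z => pairing (w z) (Z y))) y.
  by apply: (eq_derive_open _ oU Uy) => z Uz; rewrite derive_pairing_const.
rewrite H1 H2 H4 in H3.
have H5 := derive_pairing_const ('D_v Z y) eta Uy.
rewrite /ext_d H5; exact: addr_sub_eq0 H3.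
Qed.

(** In E1 - E2 + E3 the second derivatives of w cancel by symmetry, which is the closedness of dw;
    dw([X, Y], eta) is left. *)
Lemma bracket_ker_d y : U y ->
  (forall z, U z -> differentiable X z) -> (forall z, U z -> differentiable Y z) ->
  (forall z, U z -> ker_d w z (X z)) -> (forall z, U z -> ker_d w z (Y z)) ->
  ker_d w y (bracket X Y y).
Proof.
move=> Uy dX dY kX kY eta; rewrite /bracket ext_dB//.
have E1 := derive_ext_d (X y) eta Uy (dY y Uy) kY.
have E2 := derive_ext_d (Y y) eta Uy (dX y Uy) kX.
have E3 := derive_ext_d eta (Y y) Uy (dX y Uy) kX.
(* The extra term dw(D_eta X, Y) of E3 vanishes because Y lies in the kernel too. *)
have := kY y Uy ('D_eta X y); rewrite ext_dC => /eqP; rewrite oppr_eq0 => /eqP XY0.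
rewrite XY0 addr0 in E3.
have C1 : 'D_(Y y) ('D_(X y) (fun z => pairing (w z) eta)) y
        = 'D_(X y) ('D_(Y y) (fun z => pairing (w z) eta)) y.
  by apply: (derive_comm oU Uy) => [z Uz||]; [exact: smooth_on_diff (smooth_pairing _) Uz|
    exact: smooth_on_diff (smooth_on_derive _ (smooth_pairing _)) Uy..].
have C2 : 'D_(Y y) ('D_eta (fun z => pairing (w z) (X y))) y
        = 'D_eta ('D_(Y y) (fun z => pairing (w z) (X y))) y.
  by apply: (derive_comm oU Uy) => [z Uz||]; [exact: smooth_on_diff (smooth_pairing _) Uz|
    exact: smooth_on_diff (smooth_on_derive _ (smooth_pairing _)) Uy..].
rewrite C2 in E2; rewrite C1 in E1.
exact: sub_eq0_cancel E1 E2 E3.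
Qed.

End KernelInvolutive.

Section TriangularFamily.
Context {R : realType} {m k : nat}.
Local Notation V := 'M[R]_(k.+1, m).

(** Echelon form: row a is nonzero in [f a] and zero on the span of all later vectors. *)
Lemma free_triangular (f : nat -> V) (b a : nat) : (a + b <= k.+1)%N ->
  (forall r, (a <= r < a + b)%N -> row (inord r) (f r) != 0 /\ low_zero r (f r)) ->
  free [seq f r | r <- iota a b].
Proof.
elim: b a => [|b IH] a abk fT; first exact: nil_free.
rewrite /= free_cons IH ?andbT; last 2 first.
- by rewrite addSnnS.
- by move=> r rab; apply: fT; lia.
have [fa _] := fT a ltac:(lia).
apply: contra fa => fa.
have sub : (<<[seq f r | r <- iota a.+1 b]>>
    <= lker (linfun (row (inord a) : V -> 'rV[R]_m)))%VS.
  apply/span_subvP => v /mapP[r]; rewrite mem_iota => rab ->.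
  rewrite memv_ker lfunE /=; apply/eqP/rowP => i; rewrite !mxE.
  have [|_ ->//] := fT r; first by lia.
  by rewrite inordK; lia.
by have := subvP sub _ fa; rewrite memv_ker lfunE.
Qed.

End TriangularFamily.

Theorem theorem3 (R : realType) (m : nat) (M : manifold R m) (n : nat)
  (L : set (R -> M) -> R)
  (G : chart R m M -> 'M[R]_(n.*2.-1.+1, m) -> 'M[R]_(n.*2.-1.+1, m)) :
  (1 <= n)%N ->
  parametric_lagrangian n L ->
  regular n L ->
  euler_lagrange_field L G ->
  homogeneous G.
Proof.
move=> n0 [smL zerL] regL [[vG GE] kerG].
set k := n.*2.-1; have k1 : k.+1 = n.*2 by rewrite /k -addnn; lia.
have k0 : (0 < k)%N by lia.
have nk : (0 < n <= k)%N by rewrite n0 /=; lia.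
move=> W X Y [WU oW] vX vY XD YD c y ac Wy.
pose U := jlocal k (slit_jets M k) c.
have oU : open U by exact: open_jlocal_slit.
have WsubU : jlocal k W c `<=` U by move=> z [z0 /WU].
have UU' z : U z -> jlocal n (slit_jets M n) c (trunc n z) by exact: jlocal_slit_trunc.
have spanE z v : U z ->
    (v \in <<G c z :: [seq Delta r z | r <- iota 1 k]>>%VS) <->
    ker_d (hilbert_form (local_fun n L c)) z v.
  move=> Uz; have [K [dK KE]] := regL c z ac Uz.
  have y1 : row (inord 1) z != 0 by have [] := (jlocal_slit k0 z ac).1 Uz.
  have -> : <<G c z :: [seq Delta r z | r <- iota 1 k]>>%VS = K.
    (* Gamma has y_1 in row 0, and Delta^r starts in row r with r! y_1; both are nonzero on slit
       jets, so the family is triangular. *)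
    pose f r := if r is 0 then G c z else Delta r z.
    have -> : G c z :: [seq Delta r z | r <- iota 1 k] = [seq f r | r <- iota 0 k.+1].
      by congr (_ :: _); apply/eq_in_map => -[|r]; rewrite ?mem_iota.
    have ff : free [seq f r | r <- iota 0 k.+1].
      apply: free_triangular => // r; rewrite add0n => /= rk.
      case: r rk => [|r] rk.
        split=> //; apply: contra_neq y1 => /rowP G0; apply/rowP => i.
        by have := G0 i; rewrite !mxE (GE c z ac Uz).
      split; last by rewrite /f -canon_Delta//; exact: canon_low.
      apply: contra_neq y1 => /rowP D0; apply/rowP => i.
      have := D0 i; rewrite !mxE inordK// ffactnn subSS subSnn => /eqP.
      by rewrite mulf_eq0 pnatr_eq0 gtn_eqF ?fact_gt0//= => /eqP.
    apply/eqP; rewrite eqEdim; apply/andP; split; last first.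
      by rewrite dK (eqP ff) size_map size_iota k1.
    apply/span_subvP => u /mapP[r]; rewrite mem_iota /= add0n => rk ->.
    suff : [set` K] (f r) by [].
    rewrite KE; case: r rk => [|r] rk; first exact: kerG.
    exact: (Delta_ker_hilbert_form oU n0 (smL c ac) UU' (fun z Uz => zerL c z ac Uz)).
  by rewrite -KE.
have eqU z : jlocal k W c z ->
    ker_d (hilbert_form (local_fun n L c)) z =
    ker_d (hilbert_sum n (fun z => local_fun n L c (trunc n z))) z.
  move=> Wz; apply: (eq_ker_d oU (WsubU z Wz)) => x Ux.
  exact: (hilbert_formE oU n0 (smL c ac) UU').
apply/(spanE _ _ (WsubU y Wy)); rewrite (eqU _ Wy).
have sh : smooth_on U (hilbert_sum n (fun z => local_fun n L c (trunc n z))).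
  apply: smooth_hilbert_sum => //; exact: (smooth_pullback (smL c ac) UU').
apply: (bracket_ker_d (oW c ac) (smooth_on_sub WsubU sh) Wy).
- by move=> z; exact: smooth_on_diff (vX.1 c ac).
- by move=> z; exact: smooth_on_diff (vY.1 c ac).
- by move=> z Wz; rewrite -eqU//; apply/spanE; [exact: WsubU|exact: XD].
- by move=> z Wz; rewrite -eqU//; apply/spanE; [exact: WsubU|exact: YD].
Qed.
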